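(* Let $G$ be a torsion-free abelian group. Then $G$ is semi-generalized Bassian if, and only if, one of the following holds: (1) $G$ has finite rank; (2) $G \cong D \oplus R$, where $D$ is divisible (of infinite rank) and $R$ is a finite rank completely (fully) decomposable homogeneous group.
   Context: All groups are additively written abelian groups. A subgroup $H$ of a group $A$ is essential in $A$ if $H \cap S \neq \{0\}$ for every non-zero subgroup $S$ of $A$. A group $G$ is semi-generalized Bassian if, for every subgroup $H \le G$, the existence of an injective homomorphism $G \to G/H$ implies that $H$ is an essential subgroup of some direct summand of $G$. A torsion-free group is fully decomposable if it is a direct sum of rank-one groups, and homogeneous if all its non-zero elements have the same type. *)

(* Defs.v *)
From HB Require Import structures.
From mathcomp Require Import all_boot all_order all_algebra.
Set Implicit Arguments. Unset Strict Implicit. Unset Printing Implicit Defensive.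
Import GRing.Theory.
Local Open Scope ring_scope.

Definition subgroup (G : zmodType) (H : G -> Prop) : Prop :=
  H 0 /\ forall x y, H x -> H y -> H (x - y).

Definition is_hom (G Q : zmodType) (f : G -> Q) : Prop :=
  forall x y, f (x + y) = f x + f y.

Definition torsion_free (G : zmodType) : Prop :=
  forall (n : nat) (x : G), x *+ n.+1 = 0 -> x = 0.

Definition divisible (G : zmodType) : Prop :=
  forall (n : nat) (x : G), exists y : G, y *+ n.+1 = x.

Definition independent (G : zmodType) (n : nat) (x : 'I_n -> G) : Prop :=
  forall c : 'I_n -> int, \sum_(i < n) (x i *~ c i) = 0 -> forall i, c i = 0.

Definition finite_rank_in (G : zmodType) (B : G -> Prop) : Prop :=
  exists N : nat, forall (n : nat) (x : 'I_n -> G),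
    (forall i, B (x i)) -> independent x -> (n <= N)%N.

Definition finite_rank (G : zmodType) : Prop := finite_rank_in (fun _ : G => True).
Definition infinite_rank (G : zmodType) : Prop := ~ finite_rank G.

Definition rank_one_in (G : zmodType) (B : G -> Prop) : Prop :=
  (exists x, B x /\ x <> 0) /\
  forall (n : nat) (x : 'I_n -> G), (forall i, B (x i)) -> independent x -> (n <= 1)%N.

Definition essential_in (G : zmodType) (H S : G -> Prop) : Prop :=
  (forall x, H x -> S x) /\
  forall K : G -> Prop, subgroup K -> (forall x, K x -> S x) ->
    (exists x, K x /\ x <> 0) -> exists x, H x /\ K x /\ x <> 0.

Definition direct_summand (G : zmodType) (S : G -> Prop) : Prop :=
  subgroup S /\ exists T : G -> Prop, subgroup T /\
    (forall x, S x -> T x -> x = 0) /\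
    (forall x, exists s t, S s /\ T t /\ x = s + t).

Definition is_quotient (G Q : zmodType) (H : G -> Prop) (pi : G -> Q) : Prop :=
  is_hom pi /\ (forall q : Q, exists x, pi x = q) /\ (forall x, pi x = 0 <-> H x).

Definition semi_generalized_bassian (G : zmodType) : Prop :=
  forall H : G -> Prop, subgroup H ->
  forall (Q : zmodType) (pi : G -> Q), is_quotient H pi ->
    (exists phi : G -> Q, is_hom phi /\ injective phi) ->
    exists S : G -> Prop, direct_summand S /\ essential_in H S.

Definition p_div (G : zmodType) (p k : nat) (x : G) : Prop :=
  exists y : G, y *+ (p ^ k) = x.

(* x and y have the same type: their characteristics (p-heights) agree at all but
   finitely many primes, and are infinite at the same primes *)
Definition same_type (G : zmodType) (x y : G) : Prop :=
  (forall p, prime p -> ((forall k, p_div p k x) <-> (forall k, p_div p k y))) /\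
  exists N : nat, forall p, prime p -> (N < p)%N ->
    forall k, p_div p k x <-> p_div p k y.

Definition homogeneous (G : zmodType) : Prop :=
  forall x y : G, x <> 0 -> y <> 0 -> same_type x y.

Definition fully_decomposable (G : zmodType) : Prop :=
  exists (I : Type) (B : I -> G -> Prop),
    (forall i, subgroup (B i) /\ rank_one_in (B i)) /\
    (forall x : G, exists (n : nat) (idx : 'I_n -> I) (b : 'I_n -> G),
        (forall k, B (idx k) (b k)) /\ x = \sum_(k < n) b k) /\
    (forall (n : nat) (idx : 'I_n -> I) (b : 'I_n -> G),
        injective idx -> (forall k, B (idx k) (b k)) ->
        \sum_(k < n) b k = 0 -> forall k, b k = 0).

(* Main.v *)
Require Import Defs.
From HB Require Import structures.
From mathcomp Require Import all_boot all_order all_algebra.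
From mathcomp Require Import boolp classical_sets.
From mathcomp Require Import zify ring.
Set Implicit Arguments.
Unset Strict Implicit.
Unset Printing Implicit Defensive.
Import Order.TTheory GRing.Theory Num.Theory.
Local Open Scope ring_scope.

(** Since [G] is torsion-free, [H] is essential in a direct summand iff its pure
    closure is a direct summand.

    Suppose [G] is semi-generalized Bassian of infinite rank, and write
    [G = D + R] with [D] divisible and [R] reduced. If [F <= G] and [H <= F]
    are such that [F / H] is divisible and contains a copy of [F], then [G]
    embeds into [G / H], so the pure closure of [H] is a summand. For [F] free of
    countable rank inside [R] and [F / H] a rational vector space of countable
    dimension, this yields a nonzero divisible subgroup of [R]; hence [R] has
    finite rank and [D] infinite rank. For [H] a pure subgroup of rank one of
    [R] and [F = Q^(omega) + H] with [Q^(omega)] inside [D], it shows that every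
    pure subgroup of rank one of [R] is a summand, so that [R] splits into rank
    one groups; projecting onto the pure closure of [x + y] shows that the types
    of [x] and [y] agree.

    Conversely, in finite rank an embedding of [G] into [G / H] forces [H = 0]
    by counting ranks. In the second case every pure subgroup of [G] is a summand:
    by Baer's lemma this holds in [R], and it passes to [D + R] because
    divisible subgroups split off. *)

(** * Homomorphisms and subgroups *)

Section Homomorphisms.
Variables (G Q : zmodType) (f : G -> Q).
Hypothesis hf : is_hom f.

Lemma hom0 : f 0 = 0.
Proof. by apply: (addIr (f 0)); rewrite -hf !add0r. Qed.

Lemma homN x : f (- x) = - f x.
Proof. by apply: (addIr (f x)); rewrite -hf !addNr hom0. Qed.

Lemma homB x y : f (x - y) = f x - f y.
Proof. by rewrite hf homN. Qed.

Lemma homMn x n : f (x *+ n) = f x *+ n.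
Proof. by elim: n => [|n IH]; rewrite ?mulr0n ?hom0 // !mulrS hf IH. Qed.

Lemma homMz x m : f (x *~ m) = f x *~ m.
Proof. by case: m => n; rewrite ?NegzE ?mulrNz ?homN -!pmulrn homMn. Qed.

Lemma hom_sum I (r : seq I) (P : pred I) (F : I -> G) :
  f (\sum_(i <- r | P i) F i) = \sum_(i <- r | P i) f (F i).
Proof. exact: (big_morph f hf hom0). Qed.

Lemma hom_inj : (forall x, f x = 0 -> x = 0) -> injective f.
Proof.
by move=> ker0 x y fxy; apply: subr0_eq; apply: ker0; rewrite homB fxy subrr.
Qed.

End Homomorphisms.

Section Subgroups.
Variables (G : zmodType) (H : G -> Prop).
Hypothesis sH : subgroup H.

Lemma sg0 : H 0. Proof. by case: sH. Qed.

Lemma sgB x y : H x -> H y -> H (x - y). Proof. by case: sH => _; apply. Qed.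

Lemma sgN x : H x -> H (- x).
Proof. by move=> Hx; rewrite -sub0r; apply: sgB => //; apply: sg0. Qed.

Lemma sgD x y : H x -> H y -> H (x + y).
Proof. by move=> Hx Hy; rewrite -[y]opprK; apply: sgB => //; apply: sgN. Qed.

Lemma sgMn x n : H x -> H (x *+ n).
Proof.
by move=> Hx; elim: n => [|n IH]; [apply: sg0 | rewrite mulrS; apply: sgD].
Qed.

Lemma sgMz x m : H x -> H (x *~ m).
Proof.
by move=> Hx; case: m => n; rewrite ?NegzE ?mulrNz -?pmulrn;
   [|apply: sgN]; apply: sgMn.
Qed.

Lemma sg_sum I (r : seq I) (P : pred I) (F : I -> G) :
  (forall i, P i -> H (F i)) -> H (\sum_(i <- r | P i) F i).
Proof. by move=> HF; apply: big_ind => //; [apply: sg0 | apply: sgD]. Qed.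

End Subgroups.

Lemma tf_mulrz_eq0 (G : zmodType) (x : G) (m : int) :
  torsion_free G -> x *~ m = 0 -> m != 0 -> x = 0.
Proof.
move=> tf; case: m => [[|n]|n] //.
  by rewrite -pmulrn => /tf.
by rewrite NegzE mulrNz -pmulrn => /eqP; rewrite oppr_eq0 => /eqP /tf.
Qed.

Lemma tf_mulrz_inj (G : zmodType) (x y : G) (m : int) :
  torsion_free G -> m != 0 -> x *~ m = y *~ m -> x = y.
Proof.
move=> tf m0 e; apply: subr0_eq; apply: (tf_mulrz_eq0 tf _ m0).
by rewrite mulrzBl e subrr.
Qed.

(** * Extending homomorphisms into divisible groups *)

Section Extension.
Local Open Scope classical_set_scope.
Variables (G W : zmodType) (V : W -> Prop) (Gam : G * W -> Prop).
Hypotheses (tfW : torsion_free W) (sV : subgroup V).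
Hypothesis dV : forall n v, V v -> exists w, V w /\ w *+ n.+1 = v.
Hypotheses (sGam : subgroup Gam) (fGam : forall w, Gam (0, w) -> w = 0).
Hypothesis vGam : forall p, Gam p -> V p.2.

(** Partial homomorphisms are encoded by their graphs. Only a nonempty [A] has to contain [Gam], so
    that the empty union, which arises from the empty chain, is still good. *)
Let good (A : set (G * W)) : Prop :=
  [/\ forall p q, A p -> A q -> A (p - q), forall w, A (0, w) -> w = 0,
      forall p, A p -> V p.2 & forall q, A q -> Gam `<=` A].

Let good_bigcup (F : set (set (G * W))) :
  F `<=` good -> total_on F subset -> good (\bigcup_(X in F) X).
Proof.
move=> Fg Ft; split.
- move=> p q [X FX Xp] [Y FY Yq].
  have [XY|YX] := Ft _ _ FX FY.
    by exists Y => //; case: (Fg _ FY) => sY _ _ _; apply: sY => //; apply: XY.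
  by exists X => //; case: (Fg _ FX) => sX _ _ _; apply: sX => //; apply: YX.
- by move=> w [X FX Xw]; case: (Fg _ FX) => _ + _ _; apply.
- by move=> p [X FX Xw]; case: (Fg _ FX) => _ _ + _; apply.
- move=> q [X FX Xw] p Gp; exists X => //.
  by case: (Fg _ FX) => _ _ _ /(_ q Xw); apply.
Qed.

(* Torsion-freeness of [W] makes the value forced on the divisible hull of the
   domain, so that a maximal functional subgroup must be total. *)
Lemma hom_extension :
  exists f : G -> W, [/\ is_hom f, forall g, V (f g)
                       & forall g w, Gam (g, w) -> f g = w].
Proof.
have [A [gA maxA]] := Zorn_bigcup good_bigcup.
have ggam : good Gam.
  by split=> [p q|||_ _ p] //; apply: sgB.
(* An empty [A] is not maximal, since [Gam] contains 0. *)
have [Ane|Ae] := pselect (exists q, A q); last first.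
  exfalso; apply: (maxA Gam) => //; split.
    by move=> q Aq; case: Ae; exists q.
  by move=> GA; apply: Ae; exists 0; apply: GA; apply: sg0.
case: gA => subA funA valA GamA; case: Ane => q0 Aq0.
have {}GamA := GamA _ Aq0.
have sA : subgroup A by split=> //; rewrite -(subrr q0); apply: subA.
have totA g0 : exists w, A (g0, w).
  apply: contrapT => nA.
  have [v [Vv vP]] : exists v, V v /\
      forall m w, A (g0 *~ m, w) -> w = v *~ m.
    (* If a positive multiple of [g0] is in the domain, [v] is the corresponding quotient of its
       value; otherwise any [v] in [V] is compatible, and 0 is taken. *)
    have [[n [w Aw]]|none] := pselect (exists n w, A (g0 *+ n.+1, w)).
      have [v [Vv /= vn]] := dV n (valA _ Aw).
      exists v; split=> // m w' Aw'.
      apply: (@tf_mulrz_inj _ _ _ n.+1) => //.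
      apply: subr0_eq; apply: funA.
      have -> : (0, w' *~ n.+1 - v *~ m *~ n.+1) =
                (g0 *~ m, w') *~ n.+1 - (g0 *+ n.+1, w) *~ m.
        rewrite -vn; congr pair => /=.
          by rewrite !(raddfMz fst) /= pmulrn mulrzAC subrr.
        by rewrite !(raddfMz snd) /= pmulrn [v *~ m *~ _]mulrzAC.
      by apply: sgB => //; apply: sgMz.
    exists 0; split=> [|m w Aw]; first exact: sg0.
    rewrite mul0rz; case: m Aw => [[|n]|n] Aw.
    - by apply: funA; rewrite mulr0z in Aw.
    - by case: none; exists n, w; rewrite pmulrn.
    - case: none; exists n, (- w).
      have := sgN sA Aw; rewrite NegzE mulrNz.
      by congr A; congr pair; rewrite opprK pmulrn.
  pose B p := exists a m, A a /\ p = (a.1 + g0 *~ m, a.2 + v *~ m).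
  apply: (maxA B).
    split=> [p Ap|BA].
      by exists p, 0; split=> //; rewrite !mulr0z !addr0; case: p Ap.
    apply: nA; exists v; apply: BA; exists 0, 1; split; first exact: sg0.
    by rewrite !mulr1z !add0r.
  split.
  - move=> p q [a [m [Aa ->]]] [b [n [Ab ->]]].
    exists (a - b), (m - n); split; first exact: sgB.
    by congr pair => /=; rewrite mulrzBr addrACA opprD.
  - move=> w [[a1 a2] [m [Aa /= [e1 e2]]]].
    have := @vP (- m) a2; rewrite mulrNz.
    have -> : - (g0 *~ m) = a1 by apply/esym/eqP; rewrite -addr_eq0 -e1.
    by move=> /(_ Aa) a2E; rewrite e2 a2E mulrNz addNr.
  - move=> p [a [m [Aa ->]]] /=; apply: sgD => //; first exact: valA.
    exact: sgMz.
  - move=> _ _ p Gp; exists p, 0; split; first exact: GamA.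
    by rewrite !mulr0z !addr0; case: p Gp.
have [f fP] := choice totA.
have fE g w : A (g, w) -> f g = w.
  move=> Ag; apply: subr0_eq; apply: funA.
  by rewrite -(subrr g); apply: (subA (g, f g) (g, w)).
exists f; split=> [x y|g|g w Gg]; last by apply: fE; apply: GamA.
  by apply: fE; apply: (sgD sA (fP x) (fP y)).
exact: valA (fP g).
Qed.

End Extension.

Lemma hom_extension_along (F G W : zmodType) (e : F -> G) (s : F -> W) :
  torsion_free W -> divisible W -> is_hom e -> injective e -> is_hom s ->
  exists f : G -> W, is_hom f /\ forall x, f (e x) = s x.
Proof.
move=> tfW dW he ie hs.
have [||||||f [hf _ fE]] := @hom_extension G W (fun=> True)
  (fun p => exists x, p = (e x, s x)) => //.
- by move=> n v _; have [w <-] := dW n v; exists w.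
- split; first by exists 0; rewrite (hom0 he) (hom0 hs).
  by move=> _ _ [x ->] [y ->]; exists (x - y); rewrite (homB he) (homB hs).
- move=> w [x [/esym e0 ->]].
  by rewrite -(hom0 hs); congr s; apply: ie; rewrite e0 (hom0 he).
- by exists f; split=> // x; apply: fE; exists x.
Qed.

(** Extend the identity of [D]. Taking [V := D] keeps the values in [D], so [G] itself may fail to
    be divisible. *)
Lemma retraction_divisible (G : zmodType) (D : G -> Prop) :
  torsion_free G -> subgroup D ->
  (forall n x, D x -> exists y, D y /\ y *+ n.+1 = x) ->
  exists r : G -> G, [/\ is_hom r, forall x, D (r x) & forall x, D x -> r x = x].
Proof.
move=> tf sD dD.
have [||||||f [hf Df fE]] := @hom_extension G G D
  (fun p => D p.1 /\ p.1 = p.2) => //.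
- split; first by split=> //; exact: sg0.
  by move=> [x1 x2] [y1 y2] /= [Dx <-] [Dy <-]; split=> //; exact: sgB.
- by move=> w [].
- by move=> [p q] /= [Dp <-].
- by exists f; split=> // x Dx; apply: fE.
Qed.

(** * Quotients and subgroups as groups *)

Lemma quotient_exists (G : zmodType) (H : G -> Prop) :
  subgroup H -> exists (Q : zmodType) (pi : G -> Q), is_quotient H pi.
Proof.
move=> sH; pose S : {pred G} := fun x => `[< H x >].
have Sc : zmod_closed S.
  split=> [|x y /asboolP Hx /asboolP Hy]; apply/asboolP; first exact: sg0.
  exact: sgB.
pose SI := GRing.isZmodClosed.Build G S Sc.
pose I : zmodClosed G := HB.pack S SI.
exists (Quotient.quot I), (\pi_(Quotient.quot I))%qT; split; last split.
- by move=> x y; rewrite raddfD.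
- by move=> q; exists (repr q); rewrite reprK.
- move=> x; split.
    move=> /eqP; rewrite -[X in _ == X](raddf0 (\pi_(Quotient.quot I))%qT).
    by rewrite -Quotient.idealrBE subr0 => /asboolP.
  move=> Hx; apply/eqP; rewrite -[X in _ == X](raddf0 (\pi_(Quotient.quot I))%qT).
  by rewrite -Quotient.idealrBE subr0; apply/asboolP.
Qed.

Section SubgroupType.
Variables (G : zmodType) (I : zmodClosed G).
Record subgroup_type := SubgroupType { sgval : G; _ : sgval \in I }.
HB.instance Definition _ := [isSub for sgval].
HB.instance Definition _ := [Choice of subgroup_type by <:].
HB.instance Definition _ := [SubChoice_isSubZmodule of subgroup_type by <:].
End SubgroupType.

Lemma subgroup_exists (G : zmodType) (H : G -> Prop) :
  subgroup H -> exists (S : zmodType) (i : S -> G),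
    [/\ is_hom i, injective i & forall x, H x <-> exists s, i s = x].
Proof.
move=> sH; pose S : {pred G} := fun x => `[< H x >].
have Sc : zmod_closed S.
  split=> [|x y /asboolP Hx /asboolP Hy]; apply/asboolP; first exact: sg0.
  exact: sgB.
pose SI := GRing.isZmodClosed.Build G S Sc.
pose I : zmodClosed G := HB.pack S SI.
exists (subgroup_type I), (@sgval G I); split=> //.
- exact: val_inj.
- move=> x; split=> [Hx|[[y yI] <-]]; last by apply/asboolP.
  have xI : x \in I by apply/asboolP.
  by exists (SubgroupType xI).
Qed.

(** * Rank, independence and free subgroups *)

Lemma history_choice (T : Type) (P : seq T -> T -> Prop) :
  (forall s, exists x, P s x) -> exists x : nat -> T, forall n, P (mkseq x n) (x n).
Proof.
move=> /choice[next nextP].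
pose h := fix h n := if n is m.+1 then rcons (h m) (next (h m)) else [::].
exists (fun n => next (h n)) => n.
suff -> : mkseq (fun n => next (h n)) n = h n by [].
by elim: n => // n IH; rewrite mkseqS IH.
Qed.

Lemma int_left_kernel (m n : nat) (C : 'M[int]_(m, n)) :
  (n < m)%N -> exists2 u : 'rV[int]_m, u != 0 & u *m C = 0.
Proof.
move=> nm; pose M : 'M[rat]_(m, n) := map_mx intr C.
have /rowV0Pn[v /sub_kermxP vM v0] : kermx M != 0.
  by rewrite -mxrank_eq0 mxrank_ker; have := rank_leq_col M; lia.
(* The rational kernel vector is read as a polynomial in order to clear its denominators. *)
have [q [a a0 E]] := rat_poly_scale (rVpoly v).
have vE : a%:~R *: v = map_mx intr (poly_rV q : 'rV[int]_m).
  apply/rowP => i.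
  rewrite !mxE.
  have := congr1 (fun p : {poly rat} => p`_i) E.
  rewrite coefZ coef_map /= coef_rVpoly_ord => ->.
  by rewrite mulrA divff ?mul1r ?intr_eq0.
exists (poly_rV q).
  apply: contra_neq v0 => q0.
  apply: (scalerI (a := a%:~R)); first by rewrite intr_eq0.
  by rewrite vE q0 map_mx0 scaler0.
have := congr1 (fun x => a%:~R *: x) vM.
rewrite scalemxAl vE scaler0 -map_mxM => /matrixP MP.
apply/matrixP => i j; have := MP i j; rewrite !mxE => /eqP.
by rewrite intr_eq0 => /eqP.
Qed.

(** Spanning up to positive multiples, that is, spanning after tensoring with the rationals. *)
Definition spans (G : zmodType) (n : nat) (x : 'I_n -> G) : Prop :=
  forall g, exists k (c : 'I_n -> int), g *+ k.+1 = \sum_(i < n) x i *~ c i.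

(** If [n < m], the coefficient matrix has an integral relation between its rows; scaled by the
    multipliers [(k i).+1] it becomes a relation between the [y i]. *)
Lemma independent_le_spanning (G : zmodType) m n (x : 'I_n -> G) (y : 'I_m -> G) :
  (forall i, exists k (c : 'I_n -> int), y i *+ k.+1 = \sum_(j < n) x j *~ c j) ->
  independent y -> (m <= n)%N.
Proof.
move=> sp iy; rewrite leqNgt; apply/negP => nm.
have /choice[k /choice[c ckE]] := sp.
have [u u0 uC] := int_left_kernel (\matrix_(i < m, j < n) c i j) nm.
suff : u = 0 by apply/eqP.
have /iy H : \sum_(i < m) y i *~ (u 0 i * (k i).+1%:Z) = 0.
  under eq_bigr => i _.
    rewrite mulrC mulrzA -pmulrn ckE mulrz_suml.
    under eq_bigr => j _ do rewrite -mulrzA mulrC.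
    over.
  rewrite exchange_big big1 //= => j _.
  have /matrixP/(_ 0 j) := uC; rewrite !mxE => uCj.
  rewrite -[X in _ = X](mulr0z (x j)) -uCj mulrz_sumr.
  by apply: eq_bigr => i _; rewrite mxE.
by apply/rowP => i; rewrite mxE; have /eqP := H i; rewrite mulf_eq0 => /orP[/eqP|].
Qed.

Lemma spans_finite_rank (G : zmodType) n (x : 'I_n -> G) :
  spans x -> finite_rank G.
Proof.
by move=> sp; exists n => m y _; apply: (independent_le_spanning (fun i => sp (y i))).
Qed.

(** The family is [x] with [g] prepended at [ord0]. A relation with nonzero coefficient at [g]
    would, up to sign, express a positive multiple of [g] through [x]. *)
Lemma independent_consP (G : zmodType) n (g : G) (x : 'I_n -> G) :
  torsion_free G -> independent x ->
  (forall k (c : 'I_n -> int), g *+ k.+1 <> \sum_(i < n) x i *~ c i) ->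
  independent (fun i : 'I_n.+1 => oapp x g (unlift ord0 i)).
Proof.
move=> tf ix ng c; rewrite big_ord_recl unlift_none /=.
under eq_bigr => i _ do rewrite liftK /=.
have [c0|c0] := eqVneq (c ord0) 0.
  rewrite c0 mulr0z add0r => /ix H i.
  by case: (unliftP ord0 i) => [j|] ->.
move=> /eqP; rewrite addr_eq0 => /eqP E; exfalso.
case: (c ord0) c0 E => [[|k]|k] // _ E.
  apply: (ng k (fun i => - c (lift ord0 i))).
  rewrite pmulrn E -sumrN; apply: eq_bigr => i _; by rewrite mulrNz.
apply: (ng k (fun i => c (lift ord0 i))).
by rewrite pmulrn -[RHS]opprK -E NegzE mulrNz opprK.
Qed.

Lemma max_independent (G : zmodType) : finite_rank G ->
  exists n (x : 'I_n -> G), independent x /\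
    forall m (y : 'I_m -> G), independent y -> (m <= n)%N.
Proof.
move=> [N NP].
have ex : exists n, `[< exists x : 'I_n -> G, independent x >].
  by exists 0%N; apply/asboolP; exists (fun=> 0) => c _ [].
have bd n : `[< exists x : 'I_n -> G, independent x >] -> (n <= N)%N.
  by move=> /asboolP[x ix]; apply: (NP n x).
case: (ex_maxnP ex bd) => n /asboolP[x ix] nmax; exists n, x; split=> // m y iy.
by apply: nmax; apply/asboolP; exists y.
Qed.

Lemma finite_rank_spans (G : zmodType) :
  torsion_free G -> finite_rank G -> exists n (x : 'I_n -> G), spans x.
Proof.
move=> tf /max_independent[n [x [ix nmax]]]; exists n, x => g.
apply: contrapT => ng.
suff /nmax : independent (fun i : 'I_n.+1 => oapp x g (unlift ord0 i)).
  by rewrite ltnn.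
by apply: independent_consP => // k c E; apply: ng; exists k, c.
Qed.

(* The homomorphism from the free group on [nat] with basis ['X^i] that sends
   ['X^i] to [x i]. *)
Definition ev (G : zmodType) (x : nat -> G) (p : {poly int}) : G :=
  \sum_(i < size p) x i *~ p`_i.

Lemma ev_widen (G : zmodType) (x : nat -> G) (p : {poly int}) n :
  (size p <= n)%N -> ev x p = \sum_(i < n) x i *~ p`_i.
Proof.
move=> pn; rewrite /ev (big_ord_widen _ (fun i => x i *~ p`_i) pn) big_mkcond.
apply: eq_bigr => i _; case: ltnP => // sp.
by rewrite nth_default // mulr0z.
Qed.

Lemma ev_hom (G : zmodType) (x : nat -> G) : is_hom (ev x).
Proof.
move=> p q; pose n := maxn (size p) (size q).
rewrite (@ev_widen _ x p n) ?(@ev_widen _ x q n) ?(@ev_widen _ x (p + q) n);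
  rewrite ?leq_maxl ?leq_maxr ?size_polyD // -big_split.
by apply: eq_bigr => i _; rewrite coefD mulrzDr.
Qed.

Lemma evXn (G : zmodType) (x : nat -> G) n : ev x 'X^n = x n.
Proof.
rewrite /ev size_polyXn big_ord_recr /= coefXn eqxx mulr1z big1 ?add0r // => i _.
by rewrite coefXn ltn_eqF // mulr0z.
Qed.

(** Choose each [x n] with no positive multiple in the span of the earlier terms; the leading
    coefficient of a polynomial in the kernel would contradict this choice. *)
Lemma infinite_rank_ev (G : zmodType) :
  torsion_free G -> infinite_rank G -> exists x : nat -> G, injective (ev x).
Proof.
move=> tf inf.
pose outside (s : seq G) g := forall k (c : nat -> int),
  g *+ k.+1 <> \sum_(i < size s) s`_i *~ c i.
have [s|x xP] := @history_choice G outside.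
  apply: contrapT => ns; apply: inf.
  apply: (@spans_finite_rank _ (size s) (fun i => s`_i)) => g.
  apply: contrapT => ng; apply: ns; exists g => k c E.
  by apply: ng; exists k, (fun i => c i).
exists x; apply: (hom_inj (ev_hom x)) => p; rewrite /ev => E.
apply/eqP; apply: contra_eqT E => p0.
have sp : (0 < size p)%N by rewrite size_poly_gt0.
have lp : p`_(size p).-1 != 0 by rewrite -lead_coefE lead_coef_eq0.
move: sp lp; case: (size p) => // n _ /= lp; rewrite big_ord_recr /= addrC.
rewrite addr_eq0; apply/eqP => E.
have {}xP k (c : nat -> int) : x n *+ k.+1 <> \sum_(i < n) x i *~ c i.
  move=> Ek; apply: (xP n k c); rewrite Ek size_mkseq.
  by apply: eq_bigr => i _; rewrite nth_mkseq.
case pn: (p`_n) lp E => [[|k]|k] // _ E.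
  apply: (xP k (fun i => - p`_i)).
  by rewrite pmulrn E -sumrN; apply: eq_bigr => i _; rewrite mulrNz.
apply: (xP k (fun i => p`_i)).
by rewrite pmulrn -[RHS]opprK -E NegzE mulrNz opprK.
Qed.

(** * The rational vector spaces [rat] and [{poly rat}] *)

Lemma polyrat_tf : torsion_free {poly rat}.
Proof.
move=> n p /eqP; rewrite -scaler_nat scaler_eq0 pnatr_eq0 /= => /eqP //.
Qed.

Lemma polyrat_divisible : divisible {poly rat}.
Proof.
move=> n p; exists (n.+1%:R^-1 *: p).
by rewrite -scaler_nat scalerA divff ?scale1r // pnatr_eq0.
Qed.

Lemma rat_tf : torsion_free rat.
Proof. by move=> n p /eqP; rewrite mulrn_eq0 /= => /eqP. Qed.

Lemma rat_divisible : divisible rat.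
Proof.
by move=> n p; exists (p / n.+1%:R); rewrite -[LHS]mulr_natr divfK // pnatr_eq0.
Qed.

Lemma polyrat_essential (p : {poly rat}) :
  exists (q : {poly int}) (a : int), a != 0 /\ p *~ a = map_poly intr q.
Proof.
have [q [a a0 ->]] := rat_poly_scale p; exists q, a; split=> //.
by rewrite -scaler_int scalerA divff ?scale1r // intr_eq0.
Qed.

(* Shift the [V]-component of an element, which [sigma] measures, from
   [sigma g] to [iota g]: the image of [g] then still determines [g] mod [F],
   and [iota] detects the elements of [F]. *)
Lemma quotient_embedding (G V Q : zmodType) (F : G -> Prop)
    (sigma iota : G -> V) (pi : G -> Q) :
  subgroup F -> is_hom sigma -> is_hom iota ->
  (forall v, exists x, F x /\ sigma x = v) ->
  (forall x, F x -> iota x = 0 -> x = 0) ->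
  is_quotient (fun x => F x /\ sigma x = 0) pi ->
  exists phi : G -> Q, is_hom phi /\ injective phi.
Proof.
move=> sF hs hi /choice[s sP] inj [hpi [_ kpi]].
have piE x y : F (x - y) -> sigma x = sigma y -> pi x = pi y.
  move=> Fxy sxy; apply: subr0_eq; rewrite -(homB hpi); apply/kpi.
  by split=> //; rewrite (homB hs) sxy subrr.
have hps v w : pi (s (v + w)) = pi (s v + s w).
  apply: piE; last by rewrite hs !(sP _).2.
  by apply: sgB => //; [|apply: sgD] => //; apply: (sP _).1.
have hphi : is_hom (fun g => pi (s (iota g) + g - s (sigma g))).
  move=> x y /=; rewrite !(homB hpi) !hpi hi hs !hps !hpi.
  by rewrite opprD [RHS]addrACA [X in _ = X + _]addrACA.
exists (fun g => pi (s (iota g) + g - s (sigma g))); split=> //.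
apply: (hom_inj hphi) => g /kpi[Fg sg0'].
have Fg' : F g.
  have -> : g = s (iota g) + g - s (sigma g) - s (iota g) + s (sigma g).
    by rewrite [s _ + g]addrC [_ - s (iota g)]addrAC addrK subrK.
  by apply: sgD => //; [apply: sgB => //|]; apply: (sP _).1.
apply: inj => //; move: sg0'; rewrite (homB hs) hs !(sP _).2.
by rewrite addrK.
Qed.

(** * Pure subgroups and the necessity of the conditions *)

Definition pure_closure (G : zmodType) (H : G -> Prop) (x : G) : Prop :=
  exists k, H (x *+ k.+1).

Definition pure (G : zmodType) (H : G -> Prop) : Prop :=
  subgroup H /\ forall k x, H (x *+ k.+1) -> H x.

(** The pure closure of the cyclic group generated by [x]; in a torsion-free group and for nonzero
    [x], a pure subgroup of rank one. *)
Definition line (G : zmodType) (x y : G) : Prop :=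
  exists k (l : int), y *+ k.+1 = x *~ l.

(** In a torsion-free group the elements divisible by every positive integer form the largest
    divisible subgroup, so this is the usual notion there. *)
Definition reduced (G : zmodType) : Prop :=
  forall x : G, (forall n, exists y, y *+ n.+1 = x) -> x = 0.

Lemma pure_closure_pure (G : zmodType) (H : G -> Prop) :
  subgroup H -> pure (pure_closure H).
Proof.
move=> sH; split=> [|k x [l]]; last first.
  by rewrite -mulrnA mulnS => Hx; exists (l + k * l.+1)%N; move: Hx; congr H;
     congr (_ *+ _); lia.
split=> [|x y [k Hx] [l Hy]]; first by exists 0%N; rewrite mul0rn; apply: sg0.
exists (k * l + k + l)%N.
have -> : (k * l + k + l).+1 = (k.+1 * l.+1)%N by lia.
rewrite mulrnBl; apply: sgB => //; first by rewrite mulrnA; apply: sgMn.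
by rewrite mulnC mulrnA; apply: sgMn.
Qed.

Lemma pure_mulrz (G : zmodType) (H : G -> Prop) (m : int) (x : G) :
  pure H -> m != 0 -> H (x *~ m) -> H x.
Proof.
move=> [sH pH]; case: m => [[|n]|n] // _.
  by rewrite -pmulrn; apply: pH.
rewrite NegzE mulrNz -pmulrn => /(sgN sH); rewrite opprK; exact: pH.
Qed.

Lemma line_pure (G : zmodType) (x : G) : pure (line x).
Proof.
have -> : line x = pure_closure (fun y => exists l, y = x *~ l) by [].
apply: pure_closure_pure; split=> [|_ _ [k ->] [l ->]].
  by exists 0; rewrite mulr0z.
by exists (k - l); rewrite mulrzBr.
Qed.

Lemma line_refl (G : zmodType) (x : G) : line x x.
Proof. by exists 0%N, 1; rewrite mulr1z. Qed.

Lemma line_sub (G : zmodType) (K : G -> Prop) (x y : G) :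
  pure K -> K x -> line x y -> K y.
Proof. by move=> [sK pK] Kx [k [l E]]; apply: (pK k); rewrite E; apply: sgMz. Qed.

Lemma line_zero (G : zmodType) (y : G) : torsion_free G -> line 0 y -> y = 0.
Proof. by move=> tf [k [l]]; rewrite mul0rz => /tf. Qed.

Lemma tf_inj (G Q : zmodType) (f : G -> Q) :
  is_hom f -> injective f -> torsion_free Q -> torsion_free G.
Proof.
move=> hf fi tf n x x0; apply: fi; rewrite (hom0 hf); apply: (tf n).
by rewrite -(homMn hf) x0 (hom0 hf).
Qed.

Lemma summandP (G : zmodType) (S : G -> Prop) :
  direct_summand S <-> subgroup S /\ exists e : G -> G,
    [/\ is_hom e, forall x, S (e x) & forall x, S x -> e x = x].
Proof.
split=> [[sS [T [sT [ST sumST]]]]|[sS [e [he Se eS]]]].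
  split=> //.
  have /choice[e eP] : forall x, exists s, S s /\ T (x - s).
    move=> x; have [s [t [Ss [Tt ->]]]] := sumST x; exists s; split=> //.
    by rewrite addrC addKr.
  have eE x s : S s -> T (x - s) -> e x = s.
    move=> Ss Ts; apply: subr0_eq; apply: ST.
      by apply: sgB => //; apply: (eP x).1.
    have -> : e x - s = (x - s) - (x - e x).
      by rewrite opprB [RHS]addrC addrA subrK.
    by apply: sgB => //; apply: (eP x).2.
  exists e; split=> [x y|x|x Sx].
  - apply: eE; first by apply: sgD => //; apply: (eP _).1.
    by rewrite opprD addrACA; apply: sgD => //; apply: (eP _).2.
  - exact: (eP x).1.
  - by apply: eE => //; rewrite subrr; apply: sg0.
split=> //; exists (fun x => e x = 0); split; last split.
- split=> [|x y ex ey]; first exact: hom0.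
  by rewrite (homB he) ex ey subrr.
- by move=> x /eS {2}<-.
- move=> x; exists (e x), (x - e x); split=> //; split; last by rewrite subrKC.
  by rewrite (homB he) (eS (e x)) ?subrr.
Qed.

Lemma summand_pure (G : zmodType) (S : G -> Prop) :
  torsion_free G -> direct_summand S -> pure S.
Proof.
move=> tf /summandP[sS [e [he Se eS]]]; split=> // k x Sx.
suff -> : x = e x by [].
apply: subr0_eq; apply: (tf k).
by rewrite mulrnBl -(homMn he) eS ?subrr.
Qed.

(** Essentiality, tested on the cyclic group of a nonzero [x] in [S], puts a nonzero multiple of [x]
    into [H]. *)
Lemma essential_pure_closure (G : zmodType) (H S : G -> Prop) :
  subgroup H -> pure S -> essential_in H S -> S = pure_closure H.
Proof.
move=> sH [sS pS] [HS ess]; apply/predeqP => x.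
split=> [Sx|[k /HS]]; last exact: pS.
have [->|/eqP x0] := eqVneq x 0; first by exists 0%N; rewrite mul0rn; apply: sg0.
have [|||w [Hw [[m wE] w0]]] := ess (fun w => exists m, w = x *~ m).
- split=> [|_ _ [k ->] [l ->]]; first by exists 0; rewrite mulr0z.
  by exists (k - l); rewrite mulrzBr.
- by move=> _ [m ->]; apply: sgMz.
- by exists x; split=> //; exists 1; rewrite mulr1z.
rewrite {}wE in Hw w0; case: m Hw w0 => [[|k]|k] Hw w0.
- by case: w0; rewrite mulr0z.
- by exists k; rewrite pmulrn.
- by exists k; have := sgN sH Hw; rewrite NegzE mulrNz opprK pmulrn.
Qed.

Lemma bassian_pure_closure_summand (G Q : zmodType) (H : G -> Prop) (pi : G -> Q) :
  torsion_free G -> semi_generalized_bassian G -> subgroup H ->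
  is_quotient H pi -> (exists phi : G -> Q, is_hom phi /\ injective phi) ->
  direct_summand (pure_closure H).
Proof.
move=> tf sgb sH qH emb; have [S [dS eS]] := sgb H sH Q pi qH emb.
by rewrite -(essential_pure_closure sH (summand_pure tf dS) eS).
Qed.

Lemma bassian_reduced_summand_finite_rank (G R : zmodType) (i : R -> G) (r : G -> R) :
  torsion_free G -> semi_generalized_bassian G ->
  is_hom i -> is_hom r -> cancel i r -> reduced R -> finite_rank R.
Proof.
move=> tfG sgb hi hr ir red; apply: contrapT => inf.
have ii := can_inj ir.
have tfR := tf_inj hi ii tfG.
have [x xi] := infinite_rank_ev tfR inf.
pose e p := i (ev x p).
have he : is_hom e by move=> p q; rewrite /e ev_hom hi.
have ei : injective e by move=> p q /ii /xi.
(* Sending a basis to an enumeration of the countable group [{poly rat}] gives a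
   surjection from the free group of countable rank. *)
pose s0 := ev (fun n => odflt 0 (unpickle n : option {poly rat})).
have s0P v : s0 'X^(pickle v) = v by rewrite /s0 evXn pickleK.
have hs0 : is_hom s0 := ev_hom _.
have [s [hs sE]] := hom_extension_along polyrat_tf polyrat_divisible he ei hs0.
have hmap : is_hom (map_poly intr : {poly int} -> {poly rat}).
  by move=> p q; rewrite rmorphD.
have [io [hio ioE]] := hom_extension_along polyrat_tf polyrat_divisible he ei hmap.
pose F g := exists p, g = e p.
have sF : subgroup F.
  split; first by exists 0; rewrite (hom0 he).
  by move=> _ _ [p ->] [q ->]; exists (p - q); rewrite (homB he).
pose H g := F g /\ s g = 0.
have sH : subgroup H.
  split; first by split; [apply: sg0 | apply: hom0].
  by move=> g h [Fg g0] [Fh h0]; split; [apply: sgB | rewrite (homB hs) g0 h0 subrr].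
have [Q [pi qH]] := quotient_exists sH.
have emb : exists phi : G -> Q, is_hom phi /\ injective phi.
  apply: (quotient_embedding sF hs hio) qH.
    by move=> v; exists (e 'X^(pickle v)); split; [exists 'X^(pickle v)|rewrite sE].
  move=> _ [p ->]; rewrite ioE => p0; rewrite (_ : p = 0) ?(hom0 he) //.
  apply: (map_inj_poly (f := intr : int -> rat)) => //; first exact: intr_inj.
  by rewrite p0 rmorph0.
have /summandP[_ [c [hc Hc cH]]] := bassian_pure_closure_summand tfG sgb sH qH emb.
(* [f] kills the image under [ev x] of the kernel of [s0], so [f] maps the free group onto a
   quotient of [{poly rat}]. That image is divisible, hence zero in the reduced group [R]. *)
pose f y := y - r (c (i y)).
have hf : is_hom f by move=> y z; rewrite /f hi hc hr opprD addrACA.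
have f0 p : s0 p = 0 -> f (ev x p) = 0.
  move=> sp; rewrite /f cH ?ir ?subrr //; exists 0%N; split; first by exists p.
  by rewrite -[i _]/(e p) sE.
have /red : forall n, exists y, y *+ n.+1 = f (ev x 'X^(pickle (1 : {poly rat}))).
  move=> n; have [v vE] := polyrat_divisible n 1.
  exists (f (ev x 'X^(pickle v))); rewrite -(homMn hf) -(homMn (ev_hom x)).
  apply: subr0_eq; rewrite -(homB hf) -(homB (ev_hom x)); apply: f0.
  by rewrite /s0 (homB (ev_hom _)) (homMn (ev_hom _)) -/s0 !s0P vE subrr.
move=> /subr0_eq; set y := ev x _ => yE.
(* Now [y = r (c (i y))], so a positive multiple of [i y] lies in [H] and is killed by [s]; but
   [s (i y) = 1]. *)
have [k [[p pE] sk]] := Hc (i y).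
have : s (i (y *+ k.+1)) = 0.
  by rewrite yE -(homMn hr) pE ir -[i _]/(e p) -pE.
rewrite (homMn hi) (homMn hs) -[i y]/(e _) sE s0P => /polyrat_tf /eqP.
by rewrite oner_eq0.
Qed.

Lemma bassian_line_summand (G D R : zmodType)
    (j : D -> G) (d : G -> D) (i : R -> G) (r : G -> R) :
  torsion_free G -> semi_generalized_bassian G ->
  is_hom j -> is_hom d -> is_hom i -> is_hom r ->
  cancel j d -> cancel i r -> (forall x, r (j x) = 0) -> (forall x, d (i x) = 0) ->
  divisible D -> infinite_rank D ->
  forall x : R, direct_summand (line x).
Proof.
move=> tfG sgb hj hd hi hr jd ir rj di dD infD x.
have [->|/eqP x0] := eqVneq x 0.
  apply/summandP; split; first by case: (line_pure (0 : R)).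
  have tfR := tf_inj hi (can_inj ir) tfG.
  exists (fun=> 0); split=> [y z|y|y /(line_zero tfR)] //; first by rewrite addr0.
  exact: line_refl.
have tfD := tf_inj hj (can_inj jd) tfG.
have tfR := tf_inj hi (can_inj ir) tfG.
have [s si] := infinite_rank_ev tfD infD.
have hmap : is_hom (map_poly intr : {poly int} -> {poly rat}).
  by move=> p q; rewrite rmorphD.
have imap : injective (map_poly intr : {poly int} -> {poly rat}).
  by apply: map_inj_poly => //; exact: intr_inj.
(* [u] embeds [{poly rat}] into [D], and [w] below is a left inverse of it. *)
have [u [hu uE]] := hom_extension_along tfD dD hmap imap (ev_hom s).
have ui : injective u.
  apply: (hom_inj hu) => p up0; have [q [a [a0 pq]]] := polyrat_essential p.
  apply: (tf_mulrz_eq0 polyrat_tf _ a0); rewrite pq (_ : q = 0) ?rmorph0 //.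
  by apply: si; rewrite -uE -pq (homMz hu) up0 mul0rz (hom0 (ev_hom s)).
have hid : is_hom (@id {poly rat}) by [].
have [w [hw wu]] := hom_extension_along polyrat_tf polyrat_divisible hu ui hid.
have [la [hla laE]] : exists la : R -> rat, is_hom la /\
    forall m : int, la (x *~ m) = m%:~R.
  apply: (hom_extension_along rat_tf rat_divisible).
  - by move=> m n; rewrite mulrzDr.
  - apply: hom_inj => [m n|m]; first by rewrite mulrzDr.
    move=> xm; apply/eqP; apply: contra_notT x0; exact: tf_mulrz_eq0.
  - by move=> m n; rewrite rmorphD.
pose F g := exists v h, g = j (u v) + i h /\ line x h.
have sl : subgroup (line x) by case: (line_pure x).
have sF : subgroup F.
  split.
    exists 0, 0; rewrite (hom0 hu) (hom0 hj) (hom0 hi) addr0; split=> //.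
    exact: sg0.
  move=> _ _ [v [h [-> lh]]] [v' [h' [-> lh']]]; exists (v - v'), (h - h').
  rewrite (homB hu) (homB hj) (homB hi) opprD addrACA; split=> //.
  exact: sgB.
pose sg g := w (d g).
have hsg : is_hom sg by move=> g h; rewrite /sg hd hw.
have sgE v h : sg (j (u v) + i h) = v by rewrite /sg hd jd di addr0 wu.
(* Multiplication by ['X] frees the constant coefficient, which then records the component in the
   line through [la]; thus [io] is injective on [F]. *)
pose io g := 'X * sg g + (la (r g))%:P.
have hio : is_hom io.
  by move=> g h; rewrite /io hsg hr hla mulrDr polyCD addrACA.
have HE g : F g /\ sg g = 0 <-> exists h, g = i h /\ line x h.
  split=> [[[v [h [-> lh]]]]|[h [-> lh]]].
    by rewrite sgE => ->; exists h; rewrite (hom0 hu) (hom0 hj) add0r.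
  split; first by exists 0, h; rewrite (hom0 hu) (hom0 hj) add0r.
  by rewrite -[i h]add0r -(hom0 hj) -(hom0 hu) sgE.
have sH : subgroup (fun g => F g /\ sg g = 0).
  split; first by split; [apply: sg0 | apply: hom0].
  by move=> g h [Fg g0] [Fh h0]; split; [apply: sgB|rewrite (homB hsg) g0 h0 subrr].
have [Q [pi qH]] := quotient_exists sH.
have emb : exists phi : G -> Q, is_hom phi /\ injective phi.
  apply: (quotient_embedding sF hsg hio) qH.
    move=> v; exists (j (u v) + i 0); split; last exact: sgE.
    by exists v, 0; split=> //; apply: sg0.
  move=> _ [v [h [-> lh]]]; rewrite /io sgE hr rj ir add0r => E.
  have v0 : v = 0.
    apply/polyP => n; have := congr1 (fun p : {poly rat} => p`_n.+1) E.
    by rewrite /= coefD mulrC coefMX coefC !coef0 addr0.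
  have lh0 : la h = 0.
    have := congr1 (fun p : {poly rat} => p`_0) E.
    by rewrite /= coefD mulrC coefMX coefC !coef0 add0r.
  case: lh => k [l hE].
  have l0 : l = 0.
    by apply/eqP; rewrite -(intr_eq0 rat) -laE -hE (homMn hla) lh0 mul0rn.
  have -> : h = 0 by apply: (tfR k); rewrite hE l0 mulr0z.
  by rewrite v0 (hom0 hu) (hom0 hj) (hom0 hi) addr0.
have /summandP[_ [c [hc Hc cH]]] := bassian_pure_closure_summand tfG sgb sH qH emb.
apply/summandP; split=> //; exists (fun y => r (c (i y))); split.
- by move=> y z; rewrite hi hc hr.
- move=> y; have [k /HE[h [hE lh]]] := Hc (i y).
  have [_ pl] := line_pure x; apply: (pl k).
  by rewrite -(homMn hr) hE ir.
- move=> y ly; rewrite cH ?ir //; exists 0%N; apply/HE; by exists y.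
Qed.

(* [type_le x y] says that the type of [x] is at most that of [y]. *)
Definition type_le (G : zmodType) (x y : G) : Prop :=
  exists m, forall n z, z *+ n.+1 = x -> exists w, w *+ n.+1 = y *+ m.+1.

(* Project onto the line of [z = x + y]: if [x] has a nonzero image then [x] and
   [z] have comparable types; otherwise [y] is sent to [x + y], so every [n]
   dividing [y] divides [x]. Applied to the multiples of [y], the second case
   makes [x] divisible by everything. *)
Lemma lines_summand_type_le (R : zmodType) (x y : R) :
  torsion_free R -> reduced R -> (forall x : R, direct_summand (line x)) ->
  x <> 0 -> type_le x y.
Proof.
move=> tf red sl x0; apply: contrapT => ntl; apply: x0; apply: red => n.
have key y' : ~ type_le x y' -> (exists z, z *+ n.+1 = y') ->
    exists z, z *+ n.+1 = x.
  move=> ntl' [z zE].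
  have /summandP[_ [e [he le eE]]] := sl (x + y').
  have [k [l exE]] := le x.
  have [l0|l0] := eqVneq l 0; last first.
    case: ntl'.
    have lP n0 z0 : z0 *+ n0.+1 = x -> exists w, w *+ n0.+1 = y' *~ l.
      (* By [exE], [e x *+ k.+1 - x *~ l] equals [y' *~ l]; the witness is the same expression in
         [z0]. *)
      move=> z0E; exists (e z0 *+ k.+1 - z0 *~ l).
      rewrite mulrnBl -mulrnA mulnC mulrnA -(homMn he) z0E exE.
      by rewrite [z0 *~ l *+ _]pmulrn mulrzAC -pmulrn z0E mulrzDl addrC addKr.
    case: l l0 lP {exE} => [[|a]|a] // _ lP; exists a => n0 z0 /lP[w wE].
      by exists w; rewrite wE pmulrn.
    by exists (- w); rewrite mulNrn wE NegzE mulrNz opprK pmulrn.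
  have ex0 : e x = 0 by apply: (tf k); rewrite exE l0 mulr0z.
  exists (e z - z); rewrite mulrnBl -(homMn he) zE.
  have := eE (x + y') (line_refl _); rewrite he ex0 add0r => ->.
  by rewrite addrK.
apply: (key (y *+ n.+1)); last by exists y.
move=> [m mP]; apply: ntl; exists (m + n * m.+1)%N => n0 z /mP[w wE].
by exists w; rewrite wE -mulrnA; congr (_ *+ _); lia.
Qed.

(** * Divisibility by prime powers and types *)

Lemma tf_mulrn_inj (G : zmodType) (x y : G) n :
  torsion_free G -> (0 < n)%N -> x *+ n = y *+ n -> x = y.
Proof.
by move=> tf n0; rewrite !pmulrn; apply: tf_mulrz_inj => //; case: n n0.
Qed.

Lemma coprime_divides (G : zmodType) (w y : G) n m :
  coprime n m -> w *+ n = y *+ m -> exists z, z *+ n = y.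
Proof.
case: n => [|n] co E.
  move: co; rewrite /coprime gcd0n => /eqP m1; exists w.
  by rewrite E m1.
have /coprimeP := co; case=> // -[u v] /= uv.
exists (y *+ u - w *+ v); rewrite mulrnBl -!mulrnA [(v * _)%N]mulnC [w *+ _]mulrnA E.
rewrite -mulrnA.
have -> : (u * n.+1 = m * v + 1)%N by rewrite [(m * v)%N]mulnC; lia.
by rewrite mulrnDr mulr1n addrC addKr.
Qed.

(** Torsion-freeness cancels the [p]-part of [m], and coprimality removes the rest. *)
Lemma p_div_multiple (G : zmodType) (w y : G) p k m :
  torsion_free G -> prime p -> (0 < m)%N ->
  w *+ (p ^ (k + logn p m)) = y *+ m -> p_div p k y.
Proof.
move=> tf pp m0; have [m' co mE] := pfactor_coprime pp m0.
rewrite [in RHS]mE expnD !mulrnA => /tf_mulrn_inj E.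
apply: (@coprime_divides _ w y _ m'); first by rewrite coprimeXl.
by apply: E => //; rewrite expn_gt0 prime_gt0.
Qed.

(** The multiplier [m.+1] costs at most [logn p m.+1] in the [p]-height, which is finite for each
    [p] and zero for [p > m.+1]. *)
Lemma type_le_p_div (G : zmodType) (x y : G) : torsion_free G -> type_le x y ->
  (forall p, prime p -> (forall k, p_div p k x) -> forall k, p_div p k y) /\
  exists N : nat, forall p, prime p -> (N < p)%N ->
    forall k, p_div p k x -> p_div p k y.
Proof.
move=> tf [m mP].
have step p k : prime p -> p_div p (k + logn p m.+1) x -> p_div p k y.
  move=> pp [z]; have : (0 < p ^ (k + logn p m.+1))%N.
    by rewrite expn_gt0 prime_gt0.
  case pE : (p ^ _)%N => [|n] // _ /mP[w wE].
  by apply: (p_div_multiple (w := w) tf pp (ltn0Sn m)); rewrite pE.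
split=> [p pp px k|]; first by apply: step.
exists m.+1 => p pp mp k px; apply: step => //.
by rewrite lognE gtnNdvd // !andbF addn0.
Qed.

Lemma type_le_same_type (G : zmodType) (x y : G) :
  torsion_free G -> type_le x y -> type_le y x -> same_type x y.
Proof.
move=> tf /(type_le_p_div tf)[xy [N xyN]] /(type_le_p_div tf)[yx [M yxM]].
split=> [p pp|]; first by split=> ?; [apply: xy|apply: yx].
exists (maxn N M) => p pp; rewrite gtn_max => /andP[Np Mp] k.
by split=> ?; [apply: xyN|apply: yxM].
Qed.

Lemma lines_summand_homogeneous (R : zmodType) :
  torsion_free R -> reduced R -> (forall x : R, direct_summand (line x)) ->
  homogeneous R.
Proof.
by move=> tf red sl x y x0 y0; apply: type_le_same_type => //;
   apply: lines_summand_type_le.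
Qed.

(** * Splitting into lines *)

Lemma line_rank_one (G : zmodType) (x : G) : x <> 0 -> rank_one_in (line x).
Proof.
move=> x0; split; first by exists x; split=> //; apply: line_refl.
move=> n y ly; apply: (@independent_le_spanning _ _ _ (fun=> x)) => i.
by have [k [l E]] := ly i; exists k, (fun=> l); rewrite E big_ord1.
Qed.

Definition line_decomposition (R : zmodType) n (x : 'I_n -> R) (T : R -> Prop) : Prop :=
  [/\ subgroup T, forall i, x i <> 0,
      forall g, exists b t, [/\ forall i, line (x i) (b i), T t & g = \sum_i b i + t] &
      forall b t, (forall i, line (x i) (b i)) -> T t -> \sum_i b i + t = 0 ->
        t = 0 /\ forall i, b i = 0].

Lemma line_decomposition_indep (R : zmodType) n (x : 'I_n -> R) T :
  torsion_free R -> line_decomposition x T -> independent x.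
Proof.
move=> tf [sT x0 _ uniq] c E i.
have [||_ /(_ i) ci] := uniq (fun i => x i *~ c i) 0 _ (sg0 sT).
- by move=> j; exists 0%N, (c j).
- by rewrite addr0.
by apply/eqP; apply: contra_notT (x0 i); exact: tf_mulrz_eq0.
Qed.

(** [T] is pure, being a summand, so it contains the line of [t0]; the projection onto that line
    restricts to [T], and its kernel in [T] is the new remainder. *)
Lemma line_decomposition_extend (R : zmodType) n (x : 'I_n -> R) T t0 :
  torsion_free R -> (forall x : R, direct_summand (line x)) ->
  line_decomposition x T -> T t0 -> t0 <> 0 ->
  exists (x' : 'I_n.+1 -> R) T', line_decomposition x' T'.
Proof.
move=> tf sl [sT x0 dec uniq] Tt0 t00.
have pT : pure T.
  split=> // k g Tg; have [b [t [lb Tt gE]]] := dec g.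
  have Tgt : T (t *+ k.+1 - g *+ k.+1) by apply: sgB => //; apply: sgMn.
  have [||_ b0] := uniq (fun i => b i *+ k.+1) _ _ Tgt.
  - by move=> i; apply: sgMn => //; case: (line_pure (x i)).
  - by rewrite sumrMnl addrA -mulrnDl -gE subrr.
  rewrite gE big1 ?add0r // => i _; exact: (tf k).
have /summandP[_ [e [he le eE]]] := sl t0.
have Te y : T (e y) by apply: (line_sub pT Tt0).
exists (fun i => oapp x t0 (unlift ord0 i)), (fun t => T t /\ e t = 0).
split.
- split=> [|y z [Ty ey] [Tz ez]]; first by split; [apply: sg0|apply: hom0].
  by split; [apply: sgB|rewrite (homB he) ey ez subrr].
- by move=> i; case: unliftP => [k|] _ /=.
- move=> g; have [b [t [lb Tt ->]]] := dec g.
  exists (fun i => oapp b (e t) (unlift ord0 i)), (t - e t); split.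
  + by move=> i; case: unliftP => [j|] _ /=.
  + split; first by apply: sgB.
    by rewrite (homB he) (eE (e t)) ?subrr.
  rewrite big_ord_recl unlift_none /=; under [in RHS]eq_bigr do rewrite liftK /=.
  by rewrite addrAC subrKC addrC.
move=> b t lb [Tt et]; rewrite big_ord_recl => E.
have lb0 : line t0 (b ord0) by have := lb ord0; rewrite unlift_none.
have Tb0 : T (b ord0) by apply: (line_sub pT Tt0).
have [||bt bl] := uniq (fun i => b (lift ord0 i)) (b ord0 + t) _ (sgD sT Tb0 Tt).
- by move=> i; have := lb (lift ord0 i); rewrite liftK.
- by rewrite addrCA addrA.
have b0 : b ord0 = 0.
  have := congr1 e bt; rewrite he (eE _ lb0) et addr0 => ->.
  exact: hom0.
split; first by move: bt; rewrite b0 add0r.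
by move=> i; case: (unliftP ord0 i) => [k|] ->.
Qed.

Lemma lines_summand_fully_decomposable (R : zmodType) :
  torsion_free R -> finite_rank R -> (forall x : R, direct_summand (line x)) ->
  fully_decomposable R.
Proof.
move=> tf [N NP] sl.
pose P n := `[< exists (x : 'I_n -> R) T, line_decomposition x T >].
have exP : exists n, P n.
  exists 0%N; apply/asboolP; exists (fun=> 0), (fun=> True); split=> //.
  - by case.
  - by move=> g; exists (fun=> 0), g; rewrite big_ord0 add0r; split=> // -[].
  - by move=> b t _ _; rewrite big_ord0 add0r => ->; split=> // -[].
have bdP n : P n -> (n <= N)%N.
  by move=> /asboolP[x [T /(line_decomposition_indep tf) ix]]; apply: (NP n x).
case: (ex_maxnP exP bdP) => n /asboolP[x [T dxT]] nmax.
have T0 t : T t -> t = 0.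
  move=> Tt; apply: contrapT => t0.
  suff /nmax : P n.+1 by rewrite ltnn.
  by apply/asboolP; apply: line_decomposition_extend dxT Tt t0.
case: dxT => sT x0 dec uniq.
exists 'I_n, (fun i => line (x i)); split; last split.
- by move=> i; split; [case: (line_pure (x i)) | apply: line_rank_one].
- move=> g; have [b [t [lb /T0 -> ->]]] := dec g.
  by exists n, id, b; rewrite addr0.
move=> m idx b iidx lb S0 k.
(* The terms are regrouped by component; as [idx] is injective, the group at [idx k] is [b k]
   alone. *)
have [||_ /(_ (idx k))] := uniq (fun i => \sum_(k | idx k == i) b k) 0 _ (sg0 sT).
- move=> i; apply: sg_sum; first by case: (line_pure (x i)).
  by move=> l /eqP <-.
- by rewrite addr0 -[RHS]S0 [RHS](partition_big idx xpredT) //=.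
by rewrite (big_pred1 k) // => l; rewrite /= (inj_eq iidx).
Qed.

(** * The structure in infinite rank *)

Lemma finite_rank_prod (G D R : zmodType) (d : G -> D) (r : G -> R)
    (j : D -> G) (i : R -> G) :
  torsion_free D -> torsion_free R -> is_hom j -> is_hom i ->
  (forall g, g = j (d g) + i (r g)) ->
  finite_rank D -> finite_rank R -> finite_rank G.
Proof.
move=> tfD tfR hj hi gE /(finite_rank_spans tfD)[n [x sx]].
move=> /(finite_rank_spans tfR)[m [y sy]].
apply: (@spans_finite_rank _ (n + m)
  (fun k => match fintype.split k with inl a => j (x a) | inr b => i (y b) end)) => g.
have [k [c cE]] := sx (d g); have [l [c' cE']] := sy (r g).
exists (k * l + k + l)%N, (fun a => match fintype.split a with
  | inl a => c a * l.+1%:Z | inr b => c' b * k.+1%:Z end).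
rewrite big_split_ord /=.
under eq_bigr => a _.
  rewrite (unsplitK (inl a : 'I_n + 'I_m)) mulrzA -(homMz hj) -pmulrn -(homMn hj); over.
under [X in _ = _ + X]eq_bigr => a _.
  rewrite (unsplitK (inr a : 'I_n + 'I_m)) mulrzA -(homMz hi) -pmulrn -(homMn hi); over.
rewrite -!hom_sum // !sumrMnl -cE -cE' {1}(gE g) mulrnDl -!mulrnA.
by rewrite -(homMn hj) -(homMn hi); congr (j (_ *+ _) + i (_ *+ _)); lia.
Qed.

Lemma bassian_structure (G : zmodType) :
  torsion_free G -> semi_generalized_bassian G -> ~ finite_rank G ->
  exists (D R : zmodType) (f : G -> (D * R)%type),
     is_hom f /\ bijective f /\
     divisible D /\ infinite_rank D /\
     finite_rank R /\ fully_decomposable R /\ homogeneous R.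
Proof.
move=> tf sgb inf.
pose Dv (x : G) := forall n, exists y, y *+ n.+1 = x.
have sD : subgroup Dv.
  split=> [n|x y Dx Dy n]; first by exists 0; rewrite mul0rn.
  by have [z <-] := Dx n; have [w <-] := Dy n; exists (z - w); rewrite mulrnBl.
have dD n x : Dv x -> exists y, Dv y /\ y *+ n.+1 = x.
  move=> Dx; have [y yE] := Dx n; exists y; split=> // m.
  (* Divide [x] by the product of [m.+1] and [n.+1]; quotients by [n.+1] are unique, so this divides
     [y] by [m.+1]. *)
  have [z zE] := Dx (m + n * m.+1)%N; exists z; apply: (tf_mulrn_inj tf (ltn0Sn n)).
  by rewrite yE -mulrnA -zE; congr (_ *+ _); lia.
have [rho [hrho Drho rhoD]] := retraction_divisible tf sD dD.
have sR : subgroup (fun x => rho x = 0).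
  split=> [|x y rx ry]; first exact: hom0.
  by rewrite (homB hrho) rx ry subrr.
have [D [j [hj ij jP]]] := subgroup_exists sD.
have [R [i [hi ii iP]]] := subgroup_exists sR.
have /choice[d dE] : forall g, exists s, j s = rho g by move=> g; apply/jP.
have /choice[r rE] : forall g, exists s, i s = g - rho g.
  by move=> g; apply/iP; rewrite (homB hrho) (rhoD (rho g)) ?subrr.
have hd : is_hom d by move=> x y; apply: ij; rewrite hj !dE hrho.
have hr : is_hom r.
  by move=> x y; apply: ii; rewrite hi !rE hrho opprD addrACA.
have rhoj x : rho (j x) = j x by apply: rhoD; apply/jP; exists x.
have rhoi x : rho (i x) = 0 by apply/iP; exists x.
have jd : cancel j d by move=> x; apply: ij; rewrite dE.
have ir : cancel i r by move=> x; apply: ii; rewrite rE rhoi subr0.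
have rj x : r (j x) = 0 by apply: ii; rewrite rE rhoj subrr (hom0 hi).
have di x : d (i x) = 0 by apply: ij; rewrite dE rhoi (hom0 hj).
have gE g : g = j (d g) + i (r g) by rewrite dE rE subrKC.
have tfD := tf_inj hj ij tf; have tfR := tf_inj hi ii tf.
have redR : reduced R.
  move=> x xdiv; apply: ii; rewrite (hom0 hi) -(rhoi x) rhoD // => n.
  by have [y <-] := xdiv n; exists (i y); rewrite (homMn hi).
have divD : divisible D.
  move=> n x; have /(dD n)[y [/jP[z <-] zE]] : Dv (j x) by apply/jP; exists x.
  by exists z; apply: ij; rewrite (homMn hj).
have frR := bassian_reduced_summand_finite_rank tf sgb hi hr ir redR.
have infD : infinite_rank D.
  by move=> frD; apply: inf; apply: (finite_rank_prod tfD tfR hj hi gE).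
have sl := bassian_line_summand tf sgb hj hd hi hr jd ir rj di divD infD.
exists D, R, (fun g => (d g, r g)); split; first by move=> x y; rewrite hd hr.
split.
  exists (fun p => j p.1 + i p.2) => [g|[a b]] /=; first by rewrite -gE.
  by rewrite hd hr jd ir rj di addr0 add0r.
do 3![split=> //]; split; first exact: lines_summand_fully_decomposable.
exact: lines_summand_homogeneous.
Qed.

(** * Sufficiency: types and Baer's lemma *)

(** Lifts [z] of the elements [phi (x i)] are independent modulo [H], so a nonzero [h] in [H] would
    extend them to an independent family larger than the maximal one. *)
Lemma finite_rank_bassian (G : zmodType) :
  torsion_free G -> finite_rank G -> semi_generalized_bassian G.
Proof.
move=> tf /max_independent[n [x [ix nmax]]] H sH Q pi [hpi [spi kpi]] [phi [hphi iphi]].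
have phi0 c : phi (\sum_(i < n) x i *~ c i) = 0 -> forall i, c i = 0.
  by move=> E; apply: ix; apply: iphi; rewrite E (hom0 hphi).
have /choice[z zE] : forall i, exists z, pi z = phi (x i) by move=> i; apply: spi.
have pz c : pi (\sum_(i < n) z i *~ c i) = phi (\sum_(i < n) x i *~ c i).
  rewrite (hom_sum hpi) (hom_sum hphi); apply: eq_bigr => i _.
  by rewrite (homMz hpi) (homMz hphi) zE.
have H0 h : H h -> h = 0.
  move=> Hh; apply: contrapT => h0.
  suff /nmax : independent (fun i : 'I_n.+1 => oapp z h (unlift ord0 i)).
    by rewrite ltnn.
  apply: independent_consP => //.
    by move=> c E; apply: phi0; rewrite -pz E (hom0 hpi).
  move=> k c E; apply: h0; apply: (tf k); rewrite E big1 // => i _.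
  suff /phi0 -> : phi (\sum_(i < n) x i *~ c i) = 0 by rewrite mulr0z.
  by rewrite -pz -E (homMn hpi) (_ : pi h = 0) ?mul0rn //; apply/kpi.
exists (fun g => g = 0); split.
  apply/summandP; split; first by split=> // g h -> ->; rewrite subr0.
  exists (fun=> 0); split=> // g h; by rewrite addr0.
by split=> // K _ K0 [g [/K0]].
Qed.

Lemma p_div_le (G : zmodType) (x : G) p k l : (k <= l)%N -> p_div p l x -> p_div p k x.
Proof.
move=> kl [z <-]; exists (z *+ p ^ (l - k)).
by rewrite -mulrnA -expnD subnK.
Qed.

Lemma coprime_divides_mul (G : zmodType) (x : G) a b : coprime a b ->
  (exists w, w *+ a = x) -> (exists w, w *+ b = x) -> exists w, w *+ (a * b) = x.
Proof.
move=> co [w wE] [u uE].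
have [v vE] := coprime_divides co (etrans wE (esym uE)).
by exists v; rewrite mulrnA vE.
Qed.

Lemma prime_powers_divide (G : zmodType) (x : G) n : (0 < n)%N ->
  (forall p, prime p -> p_div p (logn p n) x) -> exists w, w *+ n = x.
Proof.
elim/ltn_ind: n => n IH n0 px.
have [n1|n1] := leqP n 1; first by exists x; rewrite (_ : n = 1%N) //; lia.
have pp := pdiv_prime n1.
have [n' co nE] := pfactor_coprime pp n0.
have n'0 : (0 < n')%N by move: n0; rewrite nE; case: n' {co nE}.
have a0 : (0 < logn (pdiv n) n)%N by rewrite logn_gt0 mem_primes pp n0 pdiv_dvd.
rewrite nE mulnC; apply: coprime_divides_mul; first by rewrite coprimeXl.
  exact: px.
apply: IH => //.
  rewrite [X in (_ < X)%N]nE ltn_Pmulr //.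
  by apply: leq_trans (prime_gt1 pp) _; rewrite -{1}(expn1 (pdiv n)) leq_exp2l ?prime_gt1.
move=> q qp; apply: p_div_le (px q qp); apply: dvdn_leq_log => //.
by rewrite [X in (_ %| X)%N]nE dvdn_mulr.
Qed.

Lemma same_type_type_le (G : zmodType) (x y : G) : same_type x y -> type_le x y.
Proof.
move=> [inf [N NP]].
have /choice[e eP] : forall p, exists k, (forall j, p_div p j x) \/ ~ p_div p k x.
  move=> p; have [?|] := pselect (forall j, p_div p j x); first by exists 0%N; left.
  by move=> /existsNP[k kP]; exists k; right.
(* At a prime [p <= N] where [x] has finite height, [p ^ e p] exceeds that height; at all other
   primes [y] already has the divisibility needed. *)
pose m := (\prod_(p < N.+1 | prime p) p ^ e p)%N.
have m0 : (0 < m)%N by apply: prodn_cond_gt0 => p pp; rewrite expn_gt0 prime_gt0.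
exists m.-1 => n z zE; rewrite prednK //; apply: prime_powers_divide => // p pp.
have px : p_div p (logn p n.+1) x.
  exists (z *+ (n.+1 %/ p ^ logn p n.+1)).
  by rewrite -mulrnA divnK ?pfactor_dvdnn.
suff [[w <-]|dv] : p_div p (logn p n.+1) y \/ (p ^ logn p n.+1 %| m)%N.
- by exists (w *+ m); rewrite -!mulrnA mulnC.
- by exists (y *+ (m %/ p ^ logn p n.+1)); rewrite -mulrnA divnK.
have [pN|Np] := leqP p N; last by left; apply/(NP p).
have [xinf|xfin] := eP p; first by left; apply: (inf p pp).1.
right; apply: (@dvdn_trans (p ^ e p)).
  rewrite dvdn_exp2l // leqNgt; apply/negP => /ltnW le; apply: xfin.
  exact: p_div_le px.
have pN' : (p < N.+1)%N by [].
by rewrite /m (bigD1 (Ordinal pN')) //= dvdn_mulr.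
Qed.

(** Purity allows division by the gcd [g] of [l] and [n.+1]. The cofactor [n'] is prime to [l'], so
    by Bezout it divides [x] modulo [K], hence [y]; multiplying by [g] gives the claim. *)
Lemma divides_mod_mulrz (G : zmodType) (K : G -> Prop) (x y : G) : pure K ->
  (forall n z, K (x - z *+ n.+1) -> exists w, w *+ n.+1 = y) ->
  forall n (l : int) z, K (x *~ l - z *+ n.+1) -> exists w, w *+ n.+1 = y *~ l.
Proof.
move=> pK xy n l z Kz; have sK := pK.1.
have [u [v uv]] := Bezoutz l n.+1.
set g := gcdz l n.+1 in uv.
have g0 : g != 0 by rewrite gcdz_eq0 negb_and orbT.
have /dvdzP[l' lE] : (g %| l)%Z by apply: dvdz_gcdl.
have /dvdzP[n' nE] : (g %| n.+1%:Z)%Z by apply: dvdz_gcdr.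
have n'0 : 0 < n'.
  have : 0 < n' * g by rewrite -nE.
  by rewrite pmulr_lgt0 // lt_def g0.
have bez : u * l' + v * n' = 1.
  by apply: (mulIf g0); rewrite mulrDl -!mulrA -lE -nE mul1r.
case: n' n'0 nE bez => [[|a]|] // _ nE bez.
have [w wE] : exists w, w *+ a.+1 = y.
  apply: (xy a (z *~ u + x *~ v)).
  have -> : x - (z *~ u + x *~ v) *+ a.+1 = (x *~ l' - z *~ a.+1) *~ u.
    have xE : x = x *~ l' *~ u + x *~ v *+ a.+1.
      by rewrite pmulrn -!mulrzA -mulrzDr [l' * u]mulrC bez mulr1z.
    rewrite {1}xE mulrnDl opprD addrACA subrr addr0 mulrzBl.
    by rewrite pmulrn [z *~ u *~ _]mulrzAC.
  apply: sgMz => //; apply: (pure_mulrz pK g0).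
  by rewrite mulrzBl -!mulrzA -lE -nE.
exists (w *~ l'); rewrite pmulrn nE lE !mulrzA -wE pmulrn.
by rewrite [w *~ l' *~ _]mulrzAC.
Qed.

Lemma pure_zero (G : zmodType) : torsion_free G -> pure (fun x : G => x = 0).
Proof. by move=> tf; split=> //; split=> // x y -> ->; rewrite subr0. Qed.

(** Extend the map sending [k + y *~ c] to [c]; it is well defined because no nonzero multiple of
    [y] lies in the pure subgroup [K]. *)
Lemma pure_functional (R : zmodType) (K : R -> Prop) (y : R) :
  pure K -> ~ K y ->
  exists mu : R -> rat, [/\ is_hom mu, forall x, K x -> mu x = 0 & mu y = 1].
Proof.
move=> pK Ky; have sK := pK.1.
have [||||||mu [hmu _ muE]] := @hom_extension R rat (fun=> True)
  (fun p => exists k c, K k /\ p = (k + y *~ c, c%:~R)) => //.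
- exact: rat_tf.
- by move=> n v _; have [w <-] := rat_divisible n v; exists w.
- split; first by exists 0, 0; split; [apply: sg0|rewrite mulr0z addr0].
  move=> _ _ [k [c [Kk ->]]] [k' [c' [Kk' ->]]]; exists (k - k'), (c - c').
  split; first exact: sgB.
  by congr pair => /=; rewrite ?mulrzBr ?rmorphB // opprD addrACA.
- move=> w [k [c [Kk [/esym/eqP E ->]]]].
  have [->|c0] := eqVneq c 0; first by [].
  case: Ky; apply: (pure_mulrz pK c0).
  by move: E; rewrite addrC addr_eq0 => /eqP ->; apply: sgN.
exists mu; split=> // [x Kx|]; apply: muE.
  by exists x, 0; rewrite mulr0z addr0.
by exists 0, 1; rewrite mulr1z add0r; split=> //; apply: sg0.
Qed.

(* [scales x q] says that the rational multiple [q x] exists in [G]. *)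
Definition scales (G : zmodType) (x : G) (q : rat) : Prop :=
  exists w (k l : int), [/\ k != 0, q = l%:~R / k%:~R & w *~ k = x *~ l].

Lemma scales0 (G : zmodType) (x : G) : scales x 0.
Proof. by exists 0, 1, 0; rewrite mul0r mul0rz mulr0z. Qed.

Lemma scalesD (G : zmodType) (x : G) q r : scales x q -> scales x r -> scales x (q + r).
Proof.
move=> [w [k [l [k0 -> wE]]]] [w' [k' [l' [k'0 -> wE']]]].
exists (w + w'), (k * k'), (l * k' + l' * k); split.
- by rewrite mulf_neq0.
- by rewrite rmorphD !rmorphM /=; field; rewrite !intr_eq0 k0 k'0.
- by rewrite mulrzDl mulrzA wE [k * k']mulrC mulrzA wE' -!mulrzA mulrzDr.
Qed.

Lemma scalesMz (G : zmodType) (x : G) q m : scales x q -> scales (x *~ m) q.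
Proof.
move=> [w [k [l [k0 -> wE]]]]; exists (w *~ m), k, l; split=> //.
by rewrite mulrzAC wE mulrzAC.
Qed.

Lemma rank_one_line (G : zmodType) (B : G -> Prop) (a z : G) :
  torsion_free G -> rank_one_in B -> B a -> a <> 0 -> B z -> line a z.
Proof.
move=> tf [_ r1] Ba a0 Bz; apply: contrapT => nl.
suff : (2 <= 1)%N by [].
apply: (r1 2%N (fun i : 'I_2 => oapp (fun _ : 'I_1 => a) z (unlift ord0 i))).
  by move=> i; case: unliftP => [k|] _ /=.
apply: independent_consP => //.
  move=> c; rewrite big_ord1 => E i; rewrite ord1.
  by apply/eqP; apply: contra_notT a0; exact: tf_mulrz_eq0.
by move=> k c; rewrite big_ord1 => E; apply: nl; exists k, (c 0).
Qed.

(** Nonzero elements of distinct components are independent, so the rank bounds the number of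
    components, and a longest injective enumeration is onto. *)
Lemma decomposition_finite_index (R : zmodType) (I : Type) (B : I -> R -> Prop) :
  torsion_free R -> finite_rank R -> (forall i, rank_one_in (B i)) ->
  (forall i, subgroup (B i)) ->
  (forall (n : nat) (idx : 'I_n -> I) (b : 'I_n -> R),
        injective idx -> (forall k, B (idx k) (b k)) ->
        \sum_(k < n) b k = 0 -> forall k, b k = 0) ->
  exists n (idx : 'I_n -> I), forall i, exists k, idx k = i.
Proof.
move=> tf [N NP] r1 sB uniq.
have /choice[a aP] : forall i, exists x, B i x /\ x <> 0 by move=> i; case: (r1 i).
pose P n := `[< exists idx : 'I_n -> I, injective idx >].
have exP : exists n, P n.
  exists 0%N; apply/asboolP; have f : 'I_0 -> I by case.
  by exists f => -[].
have bdP n : P n -> (n <= N)%N.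
  move=> /asboolP[idx iidx]; apply: (NP n (fun k => a (idx k))) => // c E k.
  have := uniq n idx (fun k => a (idx k) *~ c k) iidx _ E k => ak.
  apply/eqP; apply: contra_notT (aP (idx k)).2; apply: tf_mulrz_eq0 => //.
  by apply: ak => l; apply: sgMz => //; apply: (aP _).1.
case: (ex_maxnP exP bdP) => n /asboolP[idx iidx] nmax; exists n, idx => i.
apply: contrapT => ni.
suff /nmax : P n.+1 by rewrite ltnn.
apply/asboolP; exists (fun k : 'I_n.+1 => oapp idx i (unlift ord0 k)) => k l.
case: (unliftP ord0 k) => [k'|] ->; case: (unliftP ord0 l) => [l'|] -> //=.
- by move=> /iidx ->.
- by move=> E; case: ni; exists k'.
- by move=> E; case: ni; exists l'.
Qed.

(* A functional [mu] that vanishes on [K] but not at [y] has, by homogeneity, a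
   multiple whose values are multiples of [y]: this bounds the type of
   [y + K] in [R / K] by that of [y]. *)
Lemma quotient_type_le (R : zmodType) (K : R -> Prop) (y : R) :
  torsion_free R -> finite_rank R -> fully_decomposable R -> homogeneous R ->
  pure K -> ~ K y ->
  exists m, forall n z, K (y - z *+ n.+1) -> exists w, w *+ n.+1 = y *+ m.+1.
Proof.
move=> tf fr [I [B [BP [dec uniq]]]] hom pK Ky.
have y0 : y <> 0 by move=> y0; apply: Ky; rewrite y0; apply: sg0; case: pK.
have [mu [hmu muK muy]] := pure_functional pK Ky.
have [n [idx idxP]] := decomposition_finite_index tf fr
  (fun i => (BP i).2) (fun i => (BP i).1) uniq.
have /choice[M MP] : forall i, exists M : int, M != 0 /\
    forall z, B i z -> scales (y *~ M) (mu z).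
  move=> i; have [sB r1] := BP i; have [[a [Ba a0]] _] := r1.
  have [m mP] := same_type_type_le (hom a y a0 y0).
  have t0 : denq (mu a) != 0 by apply: denq_neq0.
  (* [m.+1] absorbs the discrepancy between the types of [a] and [y], and [denq (mu a)] the
     denominator of [mu a]. *)
  exists (m.+1%:Z * denq (mu a)); split; first by rewrite mulf_neq0.
  move=> z Bz; have [k [l zE]] := rank_one_line tf r1 Ba a0 Bz.
  have [w wE] : exists w, w *+ k.+1 = y *+ m.+1 *~ l.
    have az n0 z0 : a - z0 *+ n0.+1 = 0 -> exists w, w *+ n0.+1 = y *+ m.+1.
      by move=> /subr0_eq/esym; apply: mP.
    by apply: (divides_mod_mulrz (pure_zero tf) az (z := z)); rewrite zE subrr.
  exists (w *~ numq (mu a)), (k.+1%:Z * denq (mu a)), (l * numq (mu a)); split.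
  - by rewrite mulf_neq0.
  - rewrite !rmorphM /= -mulf_div divq_num_den.
    apply: (mulIf (x := k.+1%:~R)); first by rewrite intr_eq0.
    rewrite mulrAC divfK ?intr_eq0 // [RHS]mulrC.
    by rewrite !mulrzr -pmulrn -(homMn hmu) zE (homMz hmu).
  have -> : w *~ numq (mu a) *~ (k.+1%:Z * denq (mu a)) =
            w *+ k.+1 *~ (numq (mu a) * denq (mu a)).
    by rewrite pmulrn -!mulrzA; congr (_ *~ _); ring.
  by rewrite wE pmulrn -!mulrzA; congr (_ *~ _); ring.
pose MM := \prod_(k < n) M (idx k).
have sc z : scales (y *~ MM) (mu z).
  have [n0 [id0 [b [bP ->]]]] := dec z.
  rewrite (hom_sum hmu); apply: big_ind => [|q r|k _]; first exact: scales0.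
    exact: scalesD.
  have [k' k'E] := idxP (id0 k).
  rewrite /MM (bigD1 k') //= mulrzA; apply: scalesMz; rewrite k'E.
  by apply: (MP _).2.
have MM0 : MM != 0 by apply/prodf_neq0 => k _; apply: (MP _).1.
(* Here [mu z] is the inverse of [n0.+1], and [sc] says that this fraction of [y *~ MM] exists. *)
have div n0 z : K (y - z *+ n0.+1) -> exists w, w *+ n0.+1 = y *~ MM.
  move=> /muK; rewrite (homB hmu) muy (homMn hmu) => /subr0_eq E.
  have [w [k [l [k0 zE wE]]]] := sc z.
  have kE : k = l * n0.+1%:Z.
    apply: (@intr_inj rat); rewrite rmorphM /=.
    apply: (mulIf (x := k%:~R^-1)); first by rewrite invr_eq0 intr_eq0.
    by rewrite divff ?intr_eq0 // mulrAC -zE mulrzr -pmulrn.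
  have l0 : l != 0 by apply: contra_neq k0 => l0; rewrite kE l0 mul0r.
  exists w; apply: (tf_mulrz_inj tf l0).
  by rewrite -wE kE mulrC mulrzA pmulrn.
case: MM MM0 div {sc} => [[|m]|m] // _ div; exists m => n0 z /div[w wE].
  by exists w; rewrite wE pmulrn.
by exists (- w); rewrite mulNrn wE NegzE mulrNz opprK pmulrn.
Qed.

Lemma divides_mulrn (G : zmodType) (x : G) n m :
  (exists w, w *+ n = x) -> exists w, w *+ n = x *+ m.
Proof. by move=> [w <-]; exists (w *+ m); rewrite -!mulrnA mulnC. Qed.

(* Induction on [m], removing one prime [p] at a time. If [m / p] does not work
   already, [p ^ a] is the exact power of [p] dividing [y + K], say
   [y = z *+ p ^ a + ka] with [K ka]; subtracting from [y] a multiple [e] of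
   [ka] with [e = 1 mod p ^ a] repairs the [p]-height, and choosing [e]
   divisible by the part of the type discrepancy between [y] and [ka] that is
   prime to [p] leaves the other heights intact. *)
Lemma adjust_representative (R : zmodType) (K : R -> Prop) (m : nat) (y : R) :
  torsion_free R -> (forall x y : R, x <> 0 -> y <> 0 -> type_le x y) ->
  subgroup K -> (0 < m)%N ->
  (forall n z, K (y - z *+ n.+1) -> exists w, w *+ n.+1 = y *+ m) ->
  exists y', K (y - y') /\
    forall n z, K (y' - z *+ n.+1) -> exists w, w *+ n.+1 = y'.
Proof.
move=> tf tle sK; elim/ltn_ind: m y => m IH y m0 my.
have [m1|m1] := leqP m 1.
  exists y; split; first by rewrite subrr; apply: sg0.
  by move=> n z /my; rewrite (_ : m = 1%N) //; lia.
have pp := pdiv_prime m1; set p := pdiv m in pp.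
have [m' mE] : exists m', m = (m' * p)%N by apply/dvdnP; apply: pdiv_dvd.
have m'0 : (0 < m')%N by move: m0; rewrite mE; case: m' {mE}.
have m'm : (m' < m)%N by rewrite mE ltn_Pmulr ?prime_gt1.
have [m'y|] := pselect (forall n z, K (y - z *+ n.+1) -> exists w, w *+ n.+1 = y *+ m').
  exact: (IH m').
move=> /existsNP[n /existsNP[z /not_implyP[Kz nz]]].
have my' n0 z0 : (0 < n0)%N -> K (y - z0 *+ n0) -> exists w, w *+ n0 = y *+ m' *+ p.
  by case: n0 => // n0 _ /my; rewrite mE mulrnA.
have ppart n0 z0 n1 c : K (y - z0 *+ n0.+1) -> n0.+1 = (n1 * p ^ c)%N ->
    coprime p n1 -> exists w, w *+ n1 = y *+ m'.
  move=> Kz0 nE co; have [//|w wE] := my' n0.+1 z0 _ Kz0.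
  apply: (@coprime_divides _ (w *+ p ^ c) _ _ p); first by rewrite coprime_sym.
  by rewrite -wE nE mulnC mulrnA.
have [n1 co nE] := pfactor_coprime pp (ltn0Sn n).
set a := logn p n.+1 in nE.
have na : ~ exists w, w *+ p ^ a = y *+ m'.
  move=> pa; apply: nz; rewrite nE; apply: coprime_divides_mul => //.
    by rewrite coprime_sym coprimeXl.
  exact: ppart Kz nE co.
(* With [Kz] this makes [p ^ a] the exact power of [p] dividing [y] modulo [K]. *)
have Sa z0 : ~ K (y - z0 *+ p ^ a.+1).
  move=> /my'; rewrite expn_gt0 prime_gt0 // => /(_ isT)[w].
  rewrite expnSr mulrnA => /(tf_mulrn_inj tf (prime_gt0 pp)) wE.
  by apply: na; exists w.
pose z1 := z *+ n1; pose ka := y - z1 *+ p ^ a.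
have Kka : K ka by rewrite /ka /z1 -mulrnA -nE.
have ka0 : ka <> 0.
  by move=> /subr0_eq E; apply: na; apply: divides_mulrn; exists z1.
have ym0 : y *+ m' <> 0 by move=> y0; apply: na; exists 0; rewrite y0 mul0rn.
have [M MP] := tle _ _ ym0 ka0.
have [M' coM ME] := pfactor_coprime pp (ltn0Sn M).
have M'0 : (0 < M')%N by move: ME; case: M' {coM}.
(* The multiplier [e] is [u * M']: it is 1 modulo [p ^ a] and divisible by [M'], the part of [M.+1]
   prime to [p]. *)
have /(coprimeP _ M'0)[[u v] /= uv] : coprime M' (p ^ a).
  by rewrite coprime_sym coprimeXl.
pose y1 := y - ka *+ (u * M').
have Ky1 : K (y - y1) by rewrite /y1 opprB subrKC; apply: sgMn.
have Kt w : K (y1 - w) -> K (y - w).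
  by move=> Kw; have := sgD sK Ky1 Kw; rewrite addrA subrK.
have y1E : y1 = (z1 - ka *+ v) *+ p ^ a.
  have zE : z1 *+ p ^ a = y - ka by rewrite /ka opprB subrKC.
  rewrite mulrnBl -[ka *+ v *+ _]mulrnA /y1 zE.
  have -> : (u * M' = v * p ^ a + 1)%N by lia.
  by rewrite mulrnDr mulr1n opprD addrA addrAC.
have [|y2 [Ky2 y2P]] := IH m' m'm y1 m'0.
  move=> n0 z0 Kz0; have {}Kz0 := Kt _ Kz0.
  have [n2 co2 nE2] := pfactor_coprime pp (ltn0Sn n0).
  have [c2a|ac2] := leqP (logn p n0.+1) a; last first.
    case: (Sa (z0 *+ (n2 * p ^ (logn p n0.+1 - a.+1)))).
    by rewrite -mulrnA -mulnA -expnD subnK // -nE2.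
  rewrite nE2; apply: coprime_divides_mul.
  - by rewrite coprime_sym coprimeXl.
  - have [w wE] := ppart _ _ _ _ Kz0 nE2 co2.
    have n20 : (0 < n2)%N by move: nE2; case: n2 {co2 wE}.
    have [w' w'E] : exists w', w' *+ n2 = ka *+ M.+1.
      by case: n2 n20 wE {co2 nE2} => // n2 _ /MP.
    have [w2 w2E] : exists w2, w2 *+ n2 = ka *+ M'.
      apply: (@coprime_divides _ w' _ _ (p ^ logn p M.+1)).
        by rewrite coprime_sym coprimeXl.
      by rewrite w'E {1}ME mulrnA.
    exists (w - w2 *+ (u * m')).
    rewrite mulrnBl wE /y1 mulrnBl -mulrnA mulnC mulrnA w2E -!mulrnA.
    by congr (_ - _ *+ _); lia.
  - apply: divides_mulrn; apply: p_div_le c2a _.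
    by exists (z1 - ka *+ v).
exists y2; split=> //.
have := sgD sK Ky1 Ky2; by rewrite addrA subrK.
Qed.

(** Adjoin to [K] the line of a representative [y1] whose divisors are exactly its divisors modulo
    [K]. The sum is direct and again pure, so by induction it has a complement [T], and [T] plus the
    line is a complement of [K]. *)
Lemma pure_summand (R : zmodType) (K : R -> Prop) :
  torsion_free R -> finite_rank R -> fully_decomposable R -> homogeneous R ->
  pure K -> direct_summand K.
Proof.
move=> tf fr fd hom pK; have [N NP] := fr.
have tle (x y : R) : x <> 0 -> y <> 0 -> type_le x y.
  by move=> x0 y0; apply: same_type_type_le; apply: hom.
(* Induction on the corank: [K] contains [i] independent elements with [N < i + j], which is
   impossible for [j = 0]. *)
suff main j : forall (K : R -> Prop), pure K -> (exists i (x : 'I_i -> R),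
    [/\ forall k, K (x k), independent x & (N < i + j)%N]) -> direct_summand K.
  apply: (main N.+1) => //; exists 0%N, (fun=> 0); split=> // [[]|c _ []] //.
elim: j {K pK} => [|j IH] K pK [i [x [Kx ix Nij]]].
  by move: (NP i x (fun=> Logic.I) ix); rewrite addn0 in Nij; lia.
have sK := pK.1.
have [Kall|/existsNP[y Ky]] := pselect (forall x, K x).
  by apply/summandP; split=> //; exists id.
have [m mP] := quotient_type_le tf fr fd hom pK Ky.
have [y1 [Kyy1 y1P]] := adjust_representative tf tle sK (ltn0Sn m) mP.
have Ky1 : ~ K y1 by move=> Ky1; apply: Ky; have := sgD sK Kyy1 Ky1; rewrite subrK.
have ly := line_pure y1; have sl := ly.1.
have Kline b : K b -> line y1 b -> b = 0.
  move=> Kb [k [l E]]; have [l0|l0] := eqVneq l 0.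
    by apply: (tf k); rewrite E l0 mulr0z.
  by case: Ky1; apply: (pure_mulrz pK l0); rewrite -E; apply: sgMn.
pose K' g := exists k b, [/\ K k, line y1 b & g = k + b].
have pK' : pure K'.
  split.
    split; first by exists 0, 0; split; [apply: sg0|apply: sg0|rewrite addr0].
    move=> _ _ [k [b [Kk lb ->]]] [k' [b' [Kk' lb' ->]]].
    exists (k - k'), (b - b'); split; [exact: sgB|exact: sgB|].
    by rewrite opprD addrACA.
  move=> n g [k [b [Kk [s [r bE]] gE]]].
  have ns : (n.+1 * s.+1)%N = (n * s + n + s).+1 by lia.
  (* Modulo [K], [y1 *~ r] is divisible by [n.+1 * s.+1] with quotient [g]; the true quotient [w] is
     the component of [g] in the line. *)
  have [w wE] : exists w, w *+ (n * s + n + s).+1 = y1 *~ r.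
    apply: (divides_mod_mulrz pK y1P (z := g)).
    rewrite -ns mulrnA gE mulrnDl bE opprD addrCA subrr addr0.
    by apply: sgN => //; apply: sgMn.
  exists (g - w), w; split; last by rewrite subrK.
    apply: (pK.2 (n * s + n + s)%N).
    rewrite mulrnBl wE -ns mulrnA gE mulrnDl bE addrK.
    exact: sgMn.
  by exists (n * s + n + s)%N, r.
have [|sK' [T [sT [KT sumT]]]] := IH K' pK'.
  exists i.+1, (fun k => oapp x y1 (unlift ord0 k)); split.
  - move=> k; case: unliftP => [k' _|_] /=.
      by exists (x k'), 0; split; [|apply: sg0|rewrite addr0].
    by exists 0, y1; split; [apply: sg0|apply: line_refl|rewrite add0r].
  - apply: independent_consP => // k c E; apply: Ky1; apply: (pK.2 k).
    by rewrite E; apply: sg_sum => // l _; apply: sgMz.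
  - by move: Nij; lia.
split=> //; exists (fun g => exists t b, [/\ T t, line y1 b & g = t + b]); split.
  split; first by exists 0, 0; split; [apply: sg0|apply: sg0|rewrite addr0].
  move=> _ _ [k [b [Kk lb ->]]] [k' [b' [Kk' lb' ->]]].
  exists (k - k'), (b - b'); split; [exact: sgB|exact: sgB|].
  by rewrite opprD addrACA.
split=> [k Kk [t [b [Tt lb E]]]|g].
  have t0 : t = 0.
    apply: KT Tt; exists k, (- b); split=> //; first exact: sgN.
    by rewrite E addrK.
  by apply: Kline => //; rewrite E t0 add0r.
have [s [t [[k [b [Kk lb ->]]] [Tt ->]]]] := sumT g.
exists k, (t + b); split=> //; split; last by rewrite addrAC addrA.
by exists t, b.
Qed.

(** The intersection [D0] of [H] with [D] is divisible because [H] is pure, and the projection [K]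
    of [H] to [R] is pure because [D] is divisible. Complements of [D0] in [D] and of [K] in [R]
    together form a complement of [H]. *)
Lemma prod_pure_summand (D R : zmodType) (H : (D * R)%type -> Prop) :
  torsion_free D -> divisible D ->
  (forall K : R -> Prop, pure K -> direct_summand K) ->
  pure H -> direct_summand H.
Proof.
move=> tfD dD sR [sH pH].
have addE (a b : D) (c d : R) : (a, c) + (b, d) = (a + b, c + d) by [].
have mulE (a : D) (c : R) n : (a, c) *+ n = (a *+ n, c *+ n).
  by elim: n => [|n IHn]; rewrite ?mulr0n // !mulrS IHn.
pose D0 d := H (d, 0).
have sD0 : subgroup D0.
  split; first exact: (sg0 sH).
  by move=> x y Hx Hy; have := sgB sH Hx Hy; congr H; congr pair; apply: subr0.
have [rho [hrho Drho rhoD]] : exists r : D -> D,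
    [/\ is_hom r, forall x, D0 (r x) & forall x, D0 x -> r x = x].
  apply: retraction_divisible => // n x Hx; have [y yE] := dD n x; exists y.
  by split=> //; apply: (pH n); rewrite mulE yE mul0rn.
pose K r := exists d, H (d, r).
have pK : pure K.
  split.
    split; first by exists 0; apply: (sg0 sH).
    by move=> x y [d Hx] [e Hy]; exists (d - e); apply: (sgB sH Hx Hy).
  move=> k x [d Hd]; have [e eE] := dD k d; exists e; apply: (pH k).
  by rewrite mulE eE.
have [_ [T [sT [KT sumT]]]] := sR K pK.
split=> //; exists (fun p => rho p.1 = 0 /\ T p.2); split.
  split; first by split; [apply: (hom0 hrho)|apply: sg0].
  move=> [a b] [c d] /= [ra Tb] [rc Td]; split; last exact: sgB.
  by rewrite (homB hrho) ra rc subrr.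
split=> [[d r] Hdr /= [rd Tr]|[d r]].
  have r0 : r = 0 by apply: KT => //; exists d.
  by rewrite r0 in Hdr *; rewrite -(rhoD d) // rd.
have [k [t [[d1 Hd1] [Tt ->]]]] := sumT r.
(* [(d1, k)] in [H] corrects the second coordinate; the error [d - d1] in the first is then split by
   [rho]. *)
exists (d1 + rho (d - d1), k), (d - d1 - rho (d - d1), t); split; last split.
- by have := sgD sH Hd1 (Drho (d - d1)); rewrite addE addr0.
- by split=> //=; rewrite (homB hrho) (rhoD (rho _)) ?subrr.
- by congr pair; rewrite /= addrACA subrr addr0 subrKC.
Qed.

Lemma pure_summands_bassian (G : zmodType) :
  torsion_free G -> (forall H : G -> Prop, pure H -> direct_summand H) ->
  semi_generalized_bassian G.
Proof.
move=> tf sG H sH _ _ _ _; exists (pure_closure H); split.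
  by apply: sG; apply: pure_closure_pure.
split=> [x Hx|K sK KH [x [Kx x0]]]; first by exists 0%N.
have [k Hk] := KH x Kx; exists (x *+ k.+1); split=> //; split; first exact: sgMn.
by move=> /tf.
Qed.

Theorem theorem2p8 (G : zmodType) (htf : torsion_free G) :
  semi_generalized_bassian G <->
  (finite_rank G \/
   exists (D R : zmodType) (f : G -> (D * R)%type),
     is_hom f /\ bijective f /\
     divisible D /\ infinite_rank D /\
     finite_rank R /\ fully_decomposable R /\ homogeneous R).
Proof.
split=> [sgb|[fr|]].
- have [fr|inf] := pselect (finite_rank G); first by left.
  by right; apply: bassian_structure.
- exact: finite_rank_bassian.
move=> [D [R [f [hf [[g fg gf] [dD [_ [frR [fdR homR]]]]]]]]].
have hg : is_hom g by move=> x y; rewrite -[x in LHS]gf -[y in LHS]gf -hf fg.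
have ig : injective g by apply: can_inj gf.
have tfDR := tf_inj hg ig htf.
have tfD : torsion_free D.
  apply: (@tf_inj _ _ (fun d : D => (d, 0 : R))) tfDR.
    by move=> x y; congr pair; rewrite addr0.
  by move=> x y [].
have tfR : torsion_free R.
  apply: (@tf_inj _ _ (fun r : R => (0 : D, r))) tfDR.
    by move=> x y; congr pair; rewrite addr0.
  by move=> x y [].
apply: pure_summands_bassian => // H [sH pH].
(* Transport [H] to the product, split it there, and conjugate the projection back by [f] and
   [g]. *)
have /(prod_pure_summand tfD dD) : pure (fun p => H (g p)).
  split; last by move=> k x; rewrite (homMn hg); apply: pH.
  split; first by rewrite (hom0 hg); apply: sg0.
  by move=> x y Hx Hy; rewrite (homB hg); apply: sgB.
move=> /(_ (fun K => @pure_summand R K tfR frR fdR homR)) /summandP[_ [e [he He eH]]].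
apply/summandP; split=> //; exists (fun x => g (e (f x))); split=> // [x y|x Hx].
  by rewrite hf he hg.
by rewrite eH fg.
Qed.
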